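(* Let $0<\alpha<1$ and $\xi_0>0$. Let $\mathbf{H}$ be the one-step transition matrix of the random walk on a finite connected non-bipartite undirected graph with nodes $1,\dots,N$, with spectral representation $\mathbf{H}=|v_1\rangle\langle\bar v_1|+\sum_{m=2}^{N}\lambda_m|v_m\rangle\langle\bar v_m|$. For $\xi>0$ let $\mathbf{P}(t,\xi)=\sum_{n=0}^{\infty}\mathbf{H}^n\Phi^{(n)}(t,\xi)$, $t\in\mathbb{N}_0$, be the transition matrix of the fractional Bernoulli walk, where $\Phi^{(n)}(t,\xi)$ are the state probabilities of the fractional Bernoulli process (type B) with parameters $\alpha,\xi$. Then for every $t>0$, as $h\to0$ with $t/h\in\mathbb{N}$, $$\lim_{h\to0}\mathbf{P}\!\left(\frac th,\xi_0h^{\alpha}\right)=E_{\alpha}\!\left(-\xi_0(\mathbf{1}-\mathbf{H})t^{\alpha}\right)=|v_1\rangle\langle\bar v_1|+\sum_{m=2}^{N}E_{\alpha}\!\left(-\xi_0(1-\lambda_m)t^{\alpha}\right)|v_m\rangle\langle\bar v_m| .$$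
   Context: $E_\alpha(z)=\sum_{m=0}^\infty\frac{z^m}{\Gamma(\alpha m+1)}$ is the Mittag-Leffler function, applied to matrices through its power series. The graph has symmetric adjacency matrix $A_{ij}\in\{0,1\}$ with $A_{ii}=0$, node degrees $K_i=\sum_jA_{ij}$, and $H_{ij}=A_{ij}/K_i$. $|v_m\rangle$ and $\langle\bar v_m|$ are right and left eigenvectors of $\mathbf{H}$ for $\lambda_m$ ($\lambda_1=1$, $|\lambda_m|<1$ for $m\ge2$), normalized by $\langle\bar v_n|v_m\rangle=\delta_{mn}$, with $\sum_m|v_m\rangle\langle\bar v_m|=\mathbf{1}$. The fractional Bernoulli process (type B) with parameters $\alpha,\xi$ is the discrete-time renewal process with arrival times $J_0=0$, $J_n=\sum_{j=1}^nZ_j$, where the $Z_j$ are i.i.d. $\{1,2,\dots\}$-valued with generating function $\mathbb{E}u^{Z_j}=\frac{\xi u}{\xi+(1-u)^{\alpha}}$, $|u|\le1$; its state probabilities are $\Phi^{(n)}(t,\xi)=\mathbb{P}(J_n\le t<J_{n+1})$, $n,t\in\mathbb{N}_0$. *)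

(* Defs.v *)
From HB Require Import structures.
From mathcomp Require Import all_boot all_order all_algebra finmap.
From mathcomp Require Import all_classical all_reals all_analysis.

Set Implicit Arguments.
Unset Strict Implicit.
Unset Printing Implicit Defensive.

Import Order.TTheory GRing.Theory Num.Theory.
Import numFieldNormedType.Exports.

Local Open Scope classical_set_scope.
Local Open Scope ring_scope.

(* Euler's integral; only meant for 0 < s, where the integrand is integrable. *)
Definition Gamma (R : realType) (s : R) : R :=
  \int[lebesgue_measure]_(x in `]0, +oo[) (x `^ (s - 1) * expR (- x)).

Definition mittag_leffler (R : realType) (alpha z : R) : R :=
  limn (series (fun m : nat => z ^+ m / Gamma (alpha * m%:R + 1))).

(* The limit is taken in the (entrywise) topology of the space of matrices. *)
Definition mittag_leffler_mx (R : realType) (N : nat) (alpha : R)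
    (M : 'M[R]_N.+1) : 'M[R]_N.+1 :=
  limn (series (fun m : nat => (Gamma (alpha * m%:R + 1))^-1 *: M ^+ m)).

Section Graph.
Variable N : nat.

Definition simple_graph (e : rel 'I_N) : Prop := symmetric e /\ irreflexive e.

Definition graph_connected (e : rel 'I_N) : Prop := forall i j, connect e i j.

Definition bipartite (e : rel 'I_N) : Prop :=
  exists side : 'I_N -> bool, forall i j, e i j -> side i != side j.

Variable R : realType.

Definition adjacency (e : rel 'I_N) : 'M[R]_N := \matrix_(i, j) (e i j)%:R.

Definition degree (e : rel 'I_N) (i : 'I_N) : R := \sum_j adjacency e i j.

Definition walk_mx (e : rel 'I_N) : 'M[R]_N :=
  \matrix_(i, j) (adjacency e i j / degree e i).

End Graph.

(* Kets are columns, bras are rows, and the eigenvalue 1 is the one of index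
   ord0; they are real since D^(1/2) H D^(-1/2) is symmetric, D being the
   diagonal matrix of the degrees. *)
Definition spectral_data (R : realType) (N : nat) (H : 'M[R]_N.+1)
    (lambda : 'I_N.+1 -> R) (v : 'I_N.+1 -> 'cV[R]_N.+1)
    (vbar : 'I_N.+1 -> 'rV[R]_N.+1) : Prop :=
  [/\ lambda ord0 = 1 /\ (forall m, m != ord0 -> `|lambda m| < 1),
      forall m, H *m v m = lambda m *: v m,
      forall m, vbar m *m H = lambda m *: vbar m,
      (forall k m, vbar k *m v m = (k == m)%:R%:M) /\
        \sum_m v m *m vbar m = 1%:M
    & H = v ord0 *m vbar ord0
          + \sum_(m | m != ord0) lambda m *: (v m *m vbar m)].

Section RenewalProcess.
Context d (T : measurableType d) (R : realType) (P : probability T R).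

Definition mutually_independent d' (S : measurableType d')
    (X : nat -> {RV P >-> S}) : Prop :=
  forall (J : {fset nat}) (B : nat -> set S),
    (forall j, measurable (B j)) ->
    P (\bigcap_(j in [set` J]) (X j @^-1` B j)) =
      (\prod_(j <- J) P (X j @^-1` B j))%E.

Definition identically_distributed d' (S : measurableType d')
    (X : nat -> {RV P >-> S}) : Prop :=
  forall i j (B : set S), measurable B ->
    distribution P (X i) B = distribution P (X j) B.

(* The (j+1)-st waiting time is [Z j]. *)
Definition arrival_time (Z : nat -> {RV P >-> nat}) (n : nat) (w : T) : nat :=
  (\sum_(j < n) Z j w)%N.

Definition state_probability (Z : nat -> {RV P >-> nat}) (n t : nat) : R :=
  fine (P [set w | (arrival_time Z n w <= t < arrival_time Z n.+1 w)%N]).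

(* The generating function on real arguments already determines the law of the
   waiting times. *)
Definition fractional_bernoulli (alpha xi : R) (Z : nat -> {RV P >-> nat}) :
    Prop :=
  [/\ mutually_independent Z,
      identically_distributed Z,
      forall j w, (0 < Z j w)%N
    & forall j (u : R), `|u| <= 1 ->
        ('E_P[fun w => (u ^+ Z j w)%R])%E
          = (xi * u / (xi + (1 - u) `^ alpha))%:E].

Definition fb_walk (N : nat) (H : 'M[R]_N.+1) (Z : nat -> {RV P >-> nat})
    (t : nat) : 'M[R]_N.+1 :=
  limn (series (fun n : nat => state_probability Z n t *: H ^+ n)).

End RenewalProcess.

(* Main.v *)
Require Import Defs.
From HB Require Import structures.
From mathcomp Require Import all_boot all_order all_algebra finmap.
From mathcomp Require Import all_classical all_reals all_analysis.
From mathcomp Require Import measurable_realfun ring lra zify.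

Set Implicit Arguments.
Unset Strict Implicit.
Unset Printing Implicit Defensive.

Import Order.TTheory GRing.Theory Num.Theory.
Import numFieldNormedType.Exports.

Local Open Scope classical_set_scope.
Local Open Scope ring_scope.

(** The n-th powers of [H] are [sum_m lambda_m ^ n |v_m> <vbar_m|], so the
    theorem is a statement about the scalars
    [p_n = sum_k lambda ^ k Phi^(k)(n, xi)].  Let [b = (1 - X) ^ (- alpha)].  The
    renewal equation and the generating function of the waiting times give, as
    formal power series, [p (1 + xi b (1 - lambda X)) = 1 / (1 - X) + xi b],
    whence the Neumann series [p = sum_k (- xi) ^ k (1 - lambda X) ^ k
    ((1 - X) ^ (- (alpha k + 1)) + xi (1 - X) ^ (- (alpha k + alpha)))].
    With [xi = x / n ^ alpha] its k-th term has n-th coefficient tending to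
    [(- x (1 - lambda)) ^ k / Gamma (alpha k + 1)], because the n-th coefficient
    of [(1 - X) ^ (- (a + 1))] is equivalent to [n ^ a / Gamma (a + 1)].  The
    Cauchy estimate at radius [1 - c / n] dominates the terms by a geometric
    series in [k] uniformly in [n], so the limit can be taken termwise. *)

(** * The ring of formal power series *)

(** The ratio of the Neumann series has constant term [- xi], not 0, so the series does not converge
    formally: its coefficients are in general infinite sums, and their convergence is secured by a
    radius [u < 1] at which [xi (1 - u) ^ (- alpha)] is small. As [xi] is of order [n ^ (- alpha)],
    a radius with [1 - u] of order [1 / n] will do. Everything happens at real points [0 <= u < 1],
    without complex analysis: for [b >= 0] the coefficients of [(1 - X) ^ (- b)] are nonnegative, so
    the value at [u] is itself a Cauchy bound, products of series converge, and values determine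
    coefficients. Signs occur only in [- xi] and in [1 - lambda X], which costs at most a factor 2
    per power. [Gamma] enters as a limit of rescaled Beta integrals, whose reciprocals are negative
    binomial coefficients up to explicit factors. *)

Definition fps (K : Type) := nat -> K.

(** Only the additive structure is inherited from functions; under the alias [fps] the product is
    free to be the convolution. *)
HB.instance Definition _ (K : zmodType) :=
  GRing.Zmodule.copy (fps K) (nat -> K).

Section FormalPowerSeries.
Variable K : comNzRingType.
Implicit Types a b c : fps K.

Definition fps_mul a b : fps K :=
  fun n => \sum_(i < n.+1) a i * b (n - i)%N.

Definition fps_const (x : K) : fps K := fun n => if n is 0%N then x else 0.

Definition fps_trunc a (n : nat) : {poly K} := \poly_(i < n.+1) a i.

Lemma coef_fps_trunc a n i : (i <= n)%N -> (fps_trunc a n)`_i = a i.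
Proof. by move=> lein; rewrite coef_poly ltnS lein. Qed.

(** Coefficients up to [n] see only the truncations at [n]; the ring axioms are thereby borrowed
    from polynomials. *)
Lemma fps_mul_coef a b n m :
  (m <= n)%N -> fps_mul a b m = (fps_trunc a n * fps_trunc b n)`_m.
Proof.
move=> lemn; rewrite coefM; apply: eq_bigr => i _.
by rewrite !coef_fps_trunc// ?(leq_trans (leq_subr _ _))// (leq_trans _ lemn)// -ltnS.
Qed.

Lemma fps_mulC : commutative fps_mul.
Proof. by move=> a b; apply/funext => n; rewrite !(@fps_mul_coef _ _ n n)// mulrC. Qed.

Lemma fps_mulA : associative fps_mul.
Proof.
move=> a b c; apply/funext => n.
transitivity ((fps_trunc a n * (fps_trunc b n * fps_trunc c n))`_n).
  rewrite coefM; apply: eq_bigr => i _.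
  by rewrite (@fps_mul_coef _ _ n) ?leq_subr// coef_fps_trunc// -ltnS.
rewrite mulrA coefM; apply: eq_bigr => i _; have lein : (i <= n)%N by rewrite -ltnS.
by rewrite -(fps_mul_coef _ _ lein) coef_fps_trunc// leq_subr.
Qed.

Lemma fps_mul_const x a n : fps_mul (fps_const x) a n = x * a n.
Proof. by rewrite /fps_mul big_ord_recl subn0 big1 ?addr0// => i _; rewrite mul0r. Qed.

Lemma fps_mul1 : left_id (fps_const 1) fps_mul.
Proof. by move=> a; apply/funext => n; rewrite fps_mul_const mul1r. Qed.

Lemma fps_mulDl : left_distributive fps_mul +%R.
Proof.
move=> a b c; apply/funext => n; rewrite [in RHS]/GRing.add/= /fps_mul -big_split/=.
by apply: eq_bigr => i _; rewrite -mulrDl.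
Qed.

Lemma fps_const1_neq0 : fps_const 1 != 0 :> fps K.
Proof. by apply/eqP => /(congr1 (@^~ 0%N))/= /eqP; rewrite oner_eq0. Qed.

End FormalPowerSeries.

HB.instance Definition _ (K : comNzRingType) :=
  GRing.Zmodule_isComNzRing.Build (fps K) (@fps_mulA K) (@fps_mulC K)
    (@fps_mul1 K) (@fps_mulDl K) (@fps_const1_neq0 K).

Section FormalPowerSeriesTheory.
Variable K : comNzRingType.
Implicit Types a b c : fps K.

Lemma fpsM a b n : (a * b) n = \sum_(i < n.+1) a i * b (n - i)%N.
Proof. by []. Qed.

Lemma fpsD a b n : (a + b) n = a n + b n.
Proof. by []. Qed.

Lemma fpsN a n : (- a) n = - a n.
Proof. by []. Qed.

Lemma fps1 n : (1 : fps K) n = (n == 0)%:R.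
Proof. by case: n. Qed.

Lemma fpsM_const x a n : (fps_const x * a) n = x * a n.
Proof. exact: fps_mul_const. Qed.

Lemma fps_sum (I : Type) (r : seq I) (Q : pred I) (F : I -> fps K) n :
  (\sum_(i <- r | Q i) F i) n = \sum_(i <- r | Q i) F i n.
Proof. by elim/big_rec2: _ => // i x y _ <-. Qed.

Definition fps_X : fps K := fun n => (n == 1)%:R.

Lemma fpsMX a n : (fps_X * a) n = if n is m.+1 then a m else 0.
Proof.
rewrite fpsM; case: n => [|n]; first by rewrite big_ord1 mul0r.
rewrite big_ord_recl mul0r add0r big_ord_recl mul1r subn1 big1 ?addr0// => i _.
by rewrite mul0r.
Qed.

Lemma fps_expr_lt a k n : a 0%N = 0 -> (n < k)%N -> (a ^+ k) n = 0.
Proof.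
move=> a0; elim: k n => // k IHk n; rewrite ltnS => lenk.
rewrite exprS fpsM big_ord_recl a0 mul0r add0r big1// => i _.
rewrite IHk ?mulr0// lift0.
by move: (ltn_ord i) lenk; lia.
Qed.

End FormalPowerSeriesTheory.

(** * Sums of nonnegative power series *)

Section PowerSeriesSum.
Variable R : realType.
Implicit Types (a b : fps R) (u l : R).

Definition fps_ge0 a := forall n, 0 <= a n.

Definition has_sum a u l := series (fun n => a n * u ^+ n) @ \oo --> l.

(** The series [1 / (1 - X)], multiplication by which forms partial sums. *)
Definition fps_ones : fps R := fun=> 1.

Lemma fps_onesM a n : (fps_ones * a) n = series a n.+1.
Proof.
by rewrite mulrC fpsM /series/= big_mkord; apply: eq_bigr => i _; rewrite mulr1.
Qed.

Lemma fps_ge0M a b : fps_ge0 a -> fps_ge0 b -> fps_ge0 (a * b).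
Proof. by move=> a0 b0 n; rewrite fpsM sumr_ge0// => i _; rewrite mulr_ge0. Qed.

Lemma fps_ge0X a k : fps_ge0 a -> fps_ge0 (a ^+ k).
Proof.
move=> a0; elim: k => [|k IHk]; first by move=> n; rewrite expr0 fps1 ler0n.
by rewrite exprS; exact: fps_ge0M.
Qed.

Lemma nondecreasing_series_ge0 (f : nat -> R) :
  (forall n, 0 <= f n) -> nondecreasing_seq (series f).
Proof.
by move=> f0; apply/nondecreasing_seqP => n; rewrite seriesSr lerDl.
Qed.

Lemma series_le_lim (f : nat -> R) l n :
  (forall n, 0 <= f n) -> series f @ \oo --> l -> series f n <= l.
Proof.
move=> f0 fl; rewrite -(cvg_lim _ fl)//.
apply: nondecreasing_cvgn_le; first exact: nondecreasing_series_ge0.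
by apply/cvg_ex; exists l.
Qed.

Lemma has_sumD a b u l l' :
  has_sum a u l -> has_sum b u l' -> has_sum (a + b) u (l + l').
Proof.
move=> al bl; rewrite /has_sum.
rewrite (_ : series _ = series (fun n => a n * u ^+ n) + series (fun n => b n * u ^+ n)).
  exact: cvgD.
by rewrite -seriesD; congr series; apply/funext => n; rewrite fpsD mulrDl.
Qed.

Lemma has_sum_constM x a u l : has_sum a u l -> has_sum (fps_const x * a) u (x * l).
Proof.
move=> al; rewrite /has_sum.
rewrite (_ : series _ = fun n => x * series (fun n => a n * u ^+ n) n).
  by apply: cvgM => //; exact: cvg_cst.
apply/funext => n; rewrite /series/= mulr_sumr.
by apply: eq_bigr => i _; rewrite fpsM_const mulrA.
Qed.

Lemma has_sumXM a u l : has_sum a u l -> has_sum (fps_X R * a) u (u * l).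
Proof.
move=> al; rewrite /has_sum -cvg_shiftS.
rewrite (_ : [sequence _]_n = fun n => u * series (fun n => a n * u ^+ n) n).
  by apply: cvgM => //; exact: cvg_cst.
apply/funext => n; rewrite /series/= big_nat_recl// fpsMX mul0r add0r.
by rewrite mulr_sumr; apply: eq_bigr => i _; rewrite fpsMX exprS mulrCA.
Qed.

Lemma has_sum1 u : has_sum 1 u 1.
Proof.
rewrite /has_sum -cvg_shiftS; apply: cvg_near_cst; near=> n.
rewrite /= /series/= big_nat_recl// fps1 expr0 mulr1 big1 ?addr0// => i _.
by rewrite fps1 mul0r.
Unshelve. all: by end_near. Qed.

(** The substitution of [u X] for [X]; it reduces products of values at [u] to the case [u = 1]. *)
Definition fps_scale u a : fps R := fun n => a n * u ^+ n.

Lemma fps_scaleM u a b : fps_scale u (a * b) = fps_scale u a * fps_scale u b.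
Proof.
apply/funext => n; rewrite /fps_scale !fpsM mulr_suml; apply: eq_bigr => i _.
have lein : (i <= n)%N by rewrite -ltnS.
have -> : u ^+ n = u ^+ i * u ^+ (n - i) by rewrite -exprD subnKC.
ring.
Qed.

(* Both [sum_(m <= n) (a * b) m] and [sum_(i <= n) a_i (sum_(j <= n - i) b_j)]
   are the [n]-th coefficient of [fps_ones * a * b]. *)
Lemma cvg_seriesM a b l l' : fps_ge0 a -> fps_ge0 b ->
  series a @ \oo --> l -> series b @ \oo --> l' ->
  series (a * b) @ \oo --> l * l'.
Proof.
move=> a0 b0 al bl.
have sE n : series (a * b) n.+1 = \sum_(i < n.+1) a i * series b (n - i).+1.
  rewrite -fps_onesM mulrCA fpsM; apply: eq_bigr => i _.
  by rewrite fps_onesM.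
have ab0 := fps_ge0M a0 b0.
have l0 : 0 <= l by apply: le_trans (series_le_lim 0 a0 al); rewrite /series/= big_geq.
have l'0 : 0 <= l' by apply: le_trans (series_le_lim 0 b0 bl); rewrite /series/= big_geq.
have ub n : series (a * b) n <= l * l'.
  apply: (@le_trans _ _ (series (a * b) n.+1)).
    exact: nondecreasing_series_ge0.
  rewrite sE (@le_trans _ _ (series a n.+1 * l'))//; last first.
    by rewrite ler_wpM2r// series_le_lim.
  rewrite /series/= big_mkord mulr_suml ler_sum// => i _.
  by rewrite ler_wpM2l// series_le_lim.
(* The square of indices [i, j <= n] lies inside the triangle [i + j <= 2 n]. *)
have lb n : series a n.+1 * series b n.+1 <= series (a * b) (n + n).+1.
  rewrite sE -addSn big_split_ord/=.
  rewrite -[leLHS]addr0 lerD//; last first.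
    rewrite sumr_ge0// => i _; rewrite mulr_ge0//.
    by rewrite /series/= sumr_ge0.
  rewrite {1}/series/= big_mkord mulr_suml ler_sum// => i _.
  rewrite ler_wpM2l// (nondecreasing_series_ge0 b0)//.
  by rewrite ltnS -addnBA ?leq_addr// -ltnS.
have abcv : cvgn (series (a * b)).
  apply: nondecreasing_is_cvgn; first exact: nondecreasing_series_ge0.
  by exists (l * l') => _ [n _ <-].
suff <- : limn (series (a * b)) = l * l' by [].
apply/eqP; rewrite eq_le limr_le//=; last by near=> n.
have h : (series a n.+1 * series b n.+1) @[n --> \oo] --> l * l'.
  by apply: cvgM; rewrite (cvg_shiftS (series _)).
rewrite -(cvg_lim _ h)//; apply: limr_le.
  by apply/cvg_ex; exists (l * l').
near=> n; apply: le_trans (lb n) _.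
by apply: nondecreasing_cvgn_le => //; exact: nondecreasing_series_ge0.
Unshelve. all: by end_near. Qed.

Lemma fps_ge0_scale u a : 0 <= u -> fps_ge0 a -> fps_ge0 (fps_scale u a).
Proof. by move=> u0 a0 n; rewrite mulr_ge0// exprn_ge0. Qed.

Lemma has_sumM a b u l l' : 0 <= u -> fps_ge0 a -> fps_ge0 b ->
  has_sum a u l -> has_sum b u l' -> has_sum (a * b) u (l * l').
Proof.
move=> u0 a0 b0 al bl; rewrite /has_sum -/(fps_scale u (a * b)) fps_scaleM.
by apply: cvg_seriesM => //; exact: fps_ge0_scale.
Qed.

Lemma has_sum_unique a u l l' : has_sum a u l -> has_sum a u l' -> l = l'.
Proof. by move=> /cvg_lim <- // /cvg_lim <-. Qed.

End PowerSeriesSum.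

(** * Negative binomial series *)

Section CoefficientUniqueness.
Variable R : realType.
Implicit Types (a b : fps R) (u l : R).

(* Dividing by [u ^ m] and letting [u] tend to [0]. *)
Lemma has_sum_coef_le a b m : fps_ge0 a -> fps_ge0 b ->
  (forall i, (i < m)%N -> a i = b i) ->
  (forall u, 0 <= u < 1 -> exists2 l, has_sum a u l & has_sum b u l) ->
  a m <= b m.
Proof.
move=> a0 b0 abm sab.
have half01 : (0 <= 2^-1 :> R) && (2^-1 < 1 :> R) by lra.
have [l2 _ bl2] := sab _ half01.
(* The value at [1 / 2] controls all tails: for [u <= 1 / 2] and [i > m], [u ^ i <= u ^ (m + 1) 2 ^
   (m + 1) 2 ^ (- i)]. *)
pose K := 2 ^+ m.+1 * l2.
have l20 : 0 <= l2.
  apply: le_trans (series_le_lim 0 _ bl2); first by rewrite /series/= big_geq.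
  by move=> n; rewrite mulr_ge0// exprn_ge0; lra.
have K0 : 0 <= K by rewrite mulr_ge0// exprn_ge0.
have key u : 0 < u -> u <= 2^-1 -> a m <= b m + u * K.
  move=> u0 u2.
  have u01 : 0 <= u < 1 by apply/andP; split; lra.
  have [l al bl] := sab _ u01.
  pose S := \sum_(0 <= i < m) a i * u ^+ i.
  have SE : S = \sum_(0 <= i < m) b i * u ^+ i.
    by apply: eq_big_nat => i /andP[_ im]; rewrite abm.
  have aS : S + a m * u ^+ m <= l.
    rewrite /S -big_nat_recr//=; apply: (series_le_lim m.+1 _ al) => n.
    by rewrite mulr_ge0// exprn_ge0// ltW.
  have bS : l <= S + b m * u ^+ m + u ^+ m.+1 * K.
    rewrite -(cvg_lim _ bl)//; apply: limr_le; first by apply/cvg_ex; exists l.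
    near=> n; rewrite /series/= (@big_cat_nat _ _ _ m.+1)//=; last by near: n; exists m.+1.
    rewrite big_nat_recr//= -SE lerD2l.
    apply: (@le_trans _ _ (u ^+ m.+1 * (2 ^+ m.+1 * series (fun n => b n * 2^-1 ^+ n) n))).
      rewrite /series/= [in leRHS](@big_cat_nat _ _ _ m.+1)//=; last by near: n; exists m.+1.
      rewrite -[leLHS]add0r 2!mulrDr lerD//.
        rewrite mulr_ge0 ?exprn_ge0//; first exact: ltW.
        rewrite mulr_ge0 ?exprn_ge0// sumr_ge0// => i _.
        by rewrite mulr_ge0// exprn_ge0.
      rewrite 2!mulr_sumr big_nat [leRHS]big_nat ler_sum// => i /andP[mi _].
      rewrite -(subnK mi) 2!exprD [leRHS](_ : _ = b (i - m.+1 + m.+1)%N *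
        (2^-1 ^+ (i - m.+1) * u ^+ m.+1)).
        by rewrite ler_wpM2l// ler_wpM2r ?exprn_ge0 ?(ltW u0)// lerXn2r// nnegrE// ltW.
      have h : 2 ^+ m.+1 * 2^-1 ^+ m.+1 = 1 :> R.
        by rewrite -exprMn divff ?expr1n.
      rewrite [RHS](_ : _ = (2 ^+ m.+1 * 2^-1 ^+ m.+1) *
        (b (i - m.+1 + m.+1)%N * (2^-1 ^+ (i - m.+1) * u ^+ m.+1))).
        by ring.
      by rewrite h mul1r.
    rewrite ler_wpM2l// ?exprn_ge0 ?(ltW u0)// ler_wpM2l// ?exprn_ge0//.
    by apply: series_le_lim => // k; rewrite mulr_ge0// exprn_ge0.
  have um : 0 < u ^+ m by rewrite exprn_gt0.
  rewrite -(ler_pM2r um) mulrDl.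
  by move: bS aS; rewrite exprS; lra.
apply/ler_addgt0Pr => eps e0.
pose u := Num.min 2^-1 (eps / (K + 1)).
have u0 : 0 < u by rewrite lt_min invr_gt0 ltr0n/= divr_gt0//; lra.
apply: le_trans (key u u0 _) _; first by rewrite ge_min lexx.
rewrite lerD2l (@le_trans _ _ (eps / (K + 1) * K))//.
  by rewrite ler_wpM2r// ge_min lexx orbT.
by rewrite mulrAC ler_pdivrMr; [nra|lra].
Unshelve. all: by end_near. Qed.

(** The bridge from generating functions, known only through their values, to identities of formal
    series. *)
Lemma has_sum_inj a b : fps_ge0 a -> fps_ge0 b ->
  (forall u, 0 <= u < 1 -> exists2 l, has_sum a u l & has_sum b u l) ->
  a = b.
Proof.
move=> a0 b0 sab; apply/funext => m.
elim/ltn_ind: m => m IHm; apply/eqP; rewrite eq_le.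
apply/andP; split; first exact: has_sum_coef_le.
apply: has_sum_coef_le => //; first by move=> i im; rewrite IHm.
by move=> u /sab[l]; exists l.
Qed.

End CoefficientUniqueness.

(** Cauchy's functional equation. Enclosing [n x] between consecutive integers bounds
    [n |g x - x g 1|] by [g 1] for every [n], which forces the difference to vanish. *)
Lemma additive_monotone_linear (R : realType) (g : R -> R) :
  (forall x y, 0 <= x -> 0 <= y -> g (x + y) = g x + g y) ->
  (forall x y, 0 <= x -> x <= y -> g x <= g y) ->
  forall x, 0 <= x -> g x = x * g 1.
Proof.
move=> gD gle x x0.
have g0 : g 0 = 0 by have := gD 0 0 (lexx _) (lexx _); rewrite addr0; lra.
have gM n y : 0 <= y -> g (n%:R * y) = n%:R * g y.
  move=> y0; elim: n => [|n IHn]; first by rewrite !mul0r.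
  by rewrite -natr1 !mulrDl !mul1r gD ?mulr_ge0// IHn.
have g10 : 0 <= g 1 by rewrite -g0 gle.
have bound n : `|n%:R * (g x - x * g 1)| <= g 1.
  have nx0 : 0 <= n%:R * x by rewrite mulr_ge0.
  have /andP[kle ltk] := truncn_itv nx0.
  have := gle _ _ (ler0n _ _) kle; have := gle _ _ nx0 (ltW ltk).
  rewrite gM// -[_.+1%:R]mulr1 -[(Num.truncn _)%:R]mulr1 !gM// => h1 h2.
  have h3 : (Num.truncn (n%:R * x))%:R * g 1 <= n%:R * x * g 1 by rewrite ler_wpM2r.
  have h4 : n%:R * x * g 1 <= (Num.truncn (n%:R * x)).+1%:R * g 1.
    by rewrite ler_wpM2r// ltW.
  rewrite -natr1 in h1 h4.
  by rewrite ler_norml mulrBr; apply/andP; split; nra.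
apply/eqP; rewrite -subr_eq0 -normr_eq0; apply/eqP.
set D := `|_|; apply/eqP; rewrite eq_le normr_ge0 andbT leNgt; apply/negP => D0.
have := bound (Num.truncn (g 1 / D)).+1.
rewrite normrM ger0_norm// -/D leNgt => /negP; apply.
by rewrite -ltr_pdivrMr// truncnS_gt.
Qed.

Section NegativeBinomial.
Variable R : realType.
Implicit Types (b c u : R).

(* The coefficients of [(1 - X) ^ (- b)]. *)
Definition nbinom b : fps R := fun n => \prod_(j < n) ((b + j%:R) / j.+1%:R).

Lemma nbinom_0 b : nbinom b 0 = 1. Proof. by rewrite /nbinom big_ord0. Qed.

Lemma nbinomS b n : n.+1%:R * nbinom b n.+1 = (b + n%:R) * nbinom b n.
Proof.
rewrite /nbinom big_ord_recr/= mulrC -mulrA divfK; first by rewrite mulrC.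
by rewrite pnatr_eq0.
Qed.

(** Both sides are [b (b + 1) ... (b + n) / n!]. *)
Lemma nbinom_shift b n : b * nbinom (b + 1) n = (b + n%:R) * nbinom b n.
Proof.
elim: n => [|n IHn]; first by rewrite !nbinom_0 addr0.
apply: (@mulfI _ n.+1%:R); first by rewrite pnatr_eq0.
rewrite mulrCA nbinomS [RHS]mulrCA nbinomS mulrCA IHn -nat1r; ring.
Qed.

Lemma nbinom_ge0 b : 0 <= b -> fps_ge0 (nbinom b).
Proof. by move=> b0 n; rewrite prodr_ge0// => i _; rewrite divr_ge0// addr_ge0. Qed.

Lemma nbinom_le b c n : 0 <= b -> b <= c -> nbinom b n <= nbinom c n.
Proof.
move=> b0 bc; apply: ler_prod => i _; rewrite divr_ge0 ?addr_ge0//=.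
by rewrite ler_wpM2r// lerD2r.
Qed.

(** The Chu-Vandermonde identity. Multiplying the coefficient of index [n + 1] by [n + 1] is
    differentiation; Leibniz's rule and the recursion [nbinomS] of each factor give the recursion
    with parameter [b + c]. *)
Lemma nbinomM b c : nbinom b * nbinom c = nbinom (b + c).
Proof.
apply/funext; elim=> [|n IHn].
  by rewrite fpsM big_ord1 !nbinom_0 mulr1.
apply: (@mulfI _ n.+1%:R); first by rewrite pnatr_eq0.
rewrite nbinomS -IHn fpsM mulr_sumr.
transitivity (\sum_(i < n.+2) (i%:R * nbinom b i) * nbinom c (n.+1 - i)%N
  + \sum_(i < n.+2) nbinom b i * ((n.+1 - i)%:R * nbinom c (n.+1 - i)%N)).
  rewrite -big_split/=; apply: eq_bigr => i _.
  have -> : n.+1%:R = i%:R + (n.+1 - i)%:R :> R.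
    by rewrite -natrD subnKC// -ltnS.
  by ring.
rewrite big_ord_recl !mul0r add0r [X in _ + X]big_ord_recr/= subnn mul0r mulr0 addr0.
rewrite -big_split/= fpsM mulr_sumr; apply: eq_bigr => i _.
have lein : (i <= n)%N by rewrite -ltnS.
rewrite /bump/= add1n subSS nbinomS subSn// nbinomS.
have -> : n%:R = i%:R + (n - i)%:R :> R by rewrite -natrD subnKC.
move: (n - i)%N => j; ring.
Qed.

Lemma nbinom0 : nbinom 0 = 1.
Proof.
apply/funext => -[|n]; first by rewrite nbinom_0.
by rewrite /nbinom big_ord_recl add0r mul0r mul0r fps1.
Qed.

Lemma nbinom1 : nbinom 1 = fps_ones R.
Proof.
apply/funext => n; rewrite /nbinom big1// => i _.
by rewrite nat1r divff// pnatr_eq0.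
Qed.

Lemma nbinomX b k : nbinom b ^+ k = nbinom (b * k%:R).
Proof.
elim: k => [|k IHk]; first by rewrite mulr0 nbinom0.
by rewrite exprS IHk nbinomM -natr1 mulrDr mulr1 addrC.
Qed.

Lemma has_sum_ones u : 0 <= u < 1 -> has_sum (fps_ones R) u (1 - u)^-1.
Proof.
move=> /andP[u0 u1]; rewrite /has_sum -[(1 - u)^-1]mul1r.
by apply: cvg_geometric_series; rewrite ger0_norm.
Qed.

Lemma has_sum_nbinom b u : 0 <= u < 1 -> 0 <= b ->
  has_sum (nbinom b) u ((1 - u) `^ (- b)).
Proof.
move=> u01; have /andP[u0 u1] := u01.
(* For natural exponents these are powers of the geometric series; they dominate the real exponents
   and yield their convergence. *)
have nat_sum (m : nat) : exists l, has_sum (nbinom m%:R) u l.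
  elim: m => [|m [l IHm]]; first by exists 1; rewrite nbinom0; exact: has_sum1.
  exists (l * (1 - u)^-1); rewrite -natr1 -nbinomM.
  apply: has_sumM => //; [exact: nbinom_ge0|exact: nbinom_ge0|].
  by rewrite nbinom1; exact: has_sum_ones.
have nb0 c n : 0 <= c -> 0 <= nbinom c n * u ^+ n.
  by move=> c0; rewrite mulr_ge0// ?exprn_ge0// nbinom_ge0.
have cvgF c : 0 <= c -> cvgn (series (fun n => nbinom c n * u ^+ n)).
  move=> c0; have [l ml] := nat_sum (Num.truncn c).+1.
  apply: (@series_le_cvg _ _ (fun n => nbinom (Num.truncn c).+1%:R n * u ^+ n)).
  - by move=> n; exact: nb0.
  - by move=> n; exact: nb0.
  - move=> n; rewrite ler_wpM2r ?exprn_ge0// nbinom_le//.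
    by rewrite ltW// truncnS_gt.
  - by apply/cvg_ex; exists l.
pose F c := limn (series (fun n => nbinom c n * u ^+ n)).
have sumF c : 0 <= c -> has_sum (nbinom c) u (F c) by move=> /cvgF.
have F1 c : 0 <= c -> 1 <= F c.
  move=> c0; apply: le_trans (series_le_lim 1 _ (sumF _ c0)).
    by rewrite /series/= big_nat1 nbinom_0 mulr1.
  by move=> n; exact: nb0.
have Fgt0 c : 0 <= c -> F c \is Num.pos.
  by move=> /F1 h; rewrite posrE; lra.
have FD b' c : 0 <= b' -> 0 <= c -> F (b' + c) = F b' * F c.
  move=> b0 c0; apply: (has_sum_unique (sumF _ (addr_ge0 b0 c0))).
  by rewrite -nbinomM; apply: has_sumM; try exact: nbinom_ge0; try exact: sumF.
have Fle b' c : 0 <= b' -> b' <= c -> F b' <= F c.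
  move=> b0 bc; have c0 := le_trans b0 bc.
  apply: ler_lim; [exact: cvgF|exact: cvgF|].
  apply: nearW => n; apply: ler_sum => i _.
  by rewrite ler_wpM2r ?exprn_ge0// nbinom_le.
move=> b0; suff -> : (1 - u) `^ (- b) = F b by exact: sumF.
(* [F] is monotone, and multiplicative by [nbinomM], hence exponential. *)
have lnF : ln (F b) = b * ln (F 1).
  apply: (@additive_monotone_linear _ (fun c => ln (F c))) => //.
    by move=> x y x0 y0; rewrite FD// lnM ?Fgt0.
  by move=> x y x0 xy; rewrite ler_ln ?Fgt0 ?Fle// (le_trans x0).
have F1E : F 1 = (1 - u)^-1.
  apply: (has_sum_unique (sumF 1 ler01)).
  by rewrite nbinom1; exact: has_sum_ones.
apply: ln_inj; rewrite ?Fgt0// ?posrE ?powR_gt0 ?subr_gt0//.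
by rewrite ln_powR lnF F1E lnV ?posrE ?subr_gt0//; ring.
Qed.

End NegativeBinomial.

(** * The renewal process *)

Section RenewalLaw.
Context d (T : measurableType d) (R : realType) (P : probability T R).
Variable Z : nat -> {RV P >-> nat}.

Definition waiting_law : fps R := fun k => fine (P (Z 0%N @^-1` [set k])).

Lemma measurable_waiting j (B : set nat) : measurable (Z j @^-1` B).
Proof. exact: measurable_funPTI. Qed.

Lemma arrival_timeS n w : arrival_time Z n.+1 w = (arrival_time Z n w + Z n w)%N.
Proof. by rewrite /arrival_time big_ord_recr. Qed.

Lemma measurable_arrival n (B : set nat) : measurable (arrival_time Z n @^-1` B).
Proof.
have mJ : measurable_fun setT (arrival_time Z n).
  elim: n => [|n IHn].
    rewrite (_ : arrival_time Z 0 = cst 0%N); first exact: measurable_cst.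
    by apply/funext => w; rewrite /arrival_time big_ord0.
  move=> _ Y _; rewrite setTI.
  rewrite (_ : _ @^-1` _ = \bigcup_i ((arrival_time Z n @^-1` [set i]) `&`
     (Z n @^-1` [set j | Y (i + j)%N]))).
    apply: bigcup_measurable => i _; apply: measurableI.
      by rewrite -[X in measurable X]setTI; exact: IHn.
    exact: measurable_waiting.
  apply/seteqP; split=> w /=.
    by rewrite arrival_timeS => Yw; exists (arrival_time Z n w).
  by rewrite arrival_timeS => -[i _ [<-]].
by rewrite -[X in measurable X]setTI; exact: mJ.
Qed.

Lemma waiting_law_ge0 : fps_ge0 waiting_law.
Proof. by move=> k; rewrite fine_ge0. Qed.

Hypothesis Z_indep : mutually_independent Z.
Hypothesis Z_ident : identically_distributed Z.

Lemma waiting_lawE j k : P (Z j @^-1` [set k]) = (waiting_law k)%:E.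
Proof.
have h : P (Z j @^-1` [set k]) = P (Z 0%N @^-1` [set k]) by exact: Z_ident.
by rewrite h fineK// fin_num_measure//; exact: measurable_waiting.
Qed.

(** The induction carries a finite family [J] of later waiting times, so that the last summand of
    the arrival time can be moved into [J]; independence is invoked at [n = 0], once all summands
    have been moved. *)
Lemma arrival_indep n (J : {fset nat}) (B : nat -> set nat) m :
  (forall j, j \in J -> (n <= j)%N) ->
  P ((arrival_time Z n @^-1` [set m]) `&` \bigcap_(j in [set` J]) (Z j @^-1` B j))
  = (((waiting_law ^+ n) m)%:E * \prod_(j <- J) P (Z j @^-1` B j))%E.
Proof.
elim: n J B m => [|n IHn] J B m leJ.
  have -> : arrival_time Z 0 @^-1` [set m] = if m == 0 then setT else set0.
    apply/seteqP; split=> w; rewrite /= /arrival_time big_ord0.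
      by move=> <-; rewrite eqxx.
    by case: eqP => // ->.
  rewrite expr0 fps1; case: eqP => _; last by rewrite set0I measure0 mul0e.
  by rewrite setTI mul1e; exact: Z_indep.
have nJ : n \notin J by apply/negP => /leJ; rewrite ltnn.
pose C := \bigcap_(j in [set` J]) (Z j @^-1` B j).
pose F i := ((arrival_time Z n @^-1` [set i]) `&`
  ((Z n @^-1` [set j | (i + j)%N = m]) `&` C)).
have FE : (arrival_time Z n.+1 @^-1` [set m]) `&` C = \big[setU/set0]_(i < m.+1) F i.
  rewrite -bigcup_mkord; apply/seteqP; split=> w /=.
    rewrite arrival_timeS => -[Jm Cw]; exists (arrival_time Z n w) => //=.
    by rewrite -Jm ltnS leq_addr.
  by move=> [i _ [/= ji [jm Cw]]]; split => //; rewrite arrival_timeS ji.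
have mC : measurable C.
  by apply: fin_bigcap_measurable => [|j _]; [exact: finite_fset|exact: measurable_waiting].
rewrite -/C FE measure_bigsetU; first last.
- move=> i j _ _ [w [[/= <- _] [/= <- _]]] //.
- move=> i; apply: measurableI; first exact: measurable_arrival.
  by apply: measurableI => //; exact: measurable_waiting.
rewrite exprSr fpsM -sumEFin ge0_sume_distrl; last first.
  by move=> i _; rewrite lee_fin mulr_ge0//; [apply: fps_ge0X|]; exact: waiting_law_ge0.
apply: eq_bigr => i _.
(* The condition [i + Z n = m] becomes the constraint at the new index [n]. *)
pose B' j := if j == n then [set j | (i + j)%N = m] else B j.
have -> : F i = (arrival_time Z n @^-1` [set nat_of_ord i]) `&`
    \bigcap_(j in [set` (n |` J)%fset]) (Z j @^-1` B' j).
  rewrite bigcap_fsetU1 /F /B' eqxx; congr (_ `&` (_ `&` _)).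
  apply: eq_bigcapr => j /=; case: eqP => // -> nJ'; by rewrite nJ' in nJ.
have leJ' j : j \in (n |` J)%fset -> (n <= j)%N.
  by rewrite in_fset1U => /predU1P[->//|/leJ /ltnW].
apply: (etrans (IHn _ _ _ leJ')).
rewrite big_fsetU1//= EFinM -muleA; congr (_ * (_ * _))%E.
  rewrite /B' eqxx -(waiting_lawE n); congr (P (_ @^-1` _)).
  have lim' : (i <= m)%N by rewrite -ltnS.
  by apply/seteqP; split=> j /=; lia.
apply: eq_big_seq => j jJ; rewrite /B'; case: eqP => // jn.
by rewrite -jn jJ in nJ.
Qed.

Lemma arrival_law n m :
  P (arrival_time Z n @^-1` [set m]) = ((waiting_law ^+ n) m)%:E.
Proof.
have := @arrival_indep n fset0 (fun=> setT) m.
rewrite big_seq_fset0 mule1 => <- //.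
by congr (P _); apply/seteqP; split=> w //= [].
Qed.

Lemma arrival_le_law n t :
  P [set w | (arrival_time Z n w <= t)%N]
  = ((fps_ones R * waiting_law ^+ n) t)%:E.
Proof.
have -> : [set w | (arrival_time Z n w <= t)%N]
    = \big[setU/set0]_(i < t.+1) (arrival_time Z n @^-1` [set nat_of_ord i]).
  rewrite -(bigcup_mkord _ (fun i => arrival_time Z n @^-1` [set i])).
  apply/seteqP; split=> w /=; first by move=> h; exists (arrival_time Z n w).
  by move=> [i /= it ->].
rewrite (measure_bigsetU _ (F := fun i => arrival_time Z n @^-1` [set i])).
- rewrite fps_onesM /series/= big_mkord -sumEFin.
  by apply: eq_bigr => i _; exact: arrival_law.
- by move=> i; exact: measurable_arrival.
- by move=> i j _ _ [w [/= <- <-]].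
Qed.

Lemma state_probabilityE n t :
  state_probability Z n t
  = (fps_ones R * (waiting_law ^+ n - waiting_law ^+ n.+1)) t.
Proof.
rewrite /state_probability mulrBr.
have -> : [set w | (arrival_time Z n w <= t < arrival_time Z n.+1 w)%N]
    = [set w | (arrival_time Z n w <= t)%N] `\` [set w | (arrival_time Z n.+1 w <= t)%N].
  apply/seteqP; split=> w /=; first by move=> /andP[-> ]; rewrite ltnNge => /negP.
  by move=> [-> /negP]; rewrite -ltnNge.
rewrite measureD.
- rewrite setIidr.
    transitivity (fine (((fps_ones R * waiting_law ^+ n) t)%:E
                        - ((fps_ones R * waiting_law ^+ n.+1) t)%:E)%E) => //.
    by congr (fine (_ - _)%E); exact: arrival_le_law.
  move=> w /=; apply: leq_trans.
  by rewrite arrival_timeS leq_addr.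
- exact: (measurable_arrival n [set i | (i <= t)%N]).
- exact: (measurable_arrival n.+1 [set i | (i <= t)%N]).
- apply: (le_lt_trans (probability_le1 _ _)); last exact: ltry.
  exact: (measurable_arrival n [set i | (i <= t)%N]).
Qed.

(** The space is cut into the level sets of [Z 0], on each of which the integrand is constant. *)
Lemma waiting_law_gf u (l : R) : 0 <= u ->
  ('E_P[fun w => (u ^+ Z 0%N w)%R] = l%:E)%E -> has_sum waiting_law u l.
Proof.
move=> u0; rewrite expectation.unlock.
have -> : [set: T] = \bigcup_k (Z 0%N @^-1` [set k]).
  by apply/seteqP; split=> w //= _; exists (Z 0%N w).
rewrite ge0_integral_bigcup; last first.
- by move=> i j _ _ [w [/= <- <-]].
- by move=> w _; rewrite lee_fin exprn_ge0.
- move=> _ Y _; rewrite (_ : _ @^-1` _ = Z 0%N @^-1` [set k | Y (u ^+ k)%:E])//.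
  by apply: measurableI; [apply: bigcup_measurable => k _|]; exact: measurable_waiting.
- by move=> k; exact: measurable_waiting.
move=> sl; rewrite /has_sum.
have cvgs : (fun n => \sum_(0 <= i < n) \int[P]_(x in Z 0%N @^-1` [set i]) (u ^+ Z 0%N x)%:E)%E
    @ \oo --> l%:E.
  rewrite -sl; apply: is_cvg_nneseries => n _ _.
  by apply: integral_ge0 => w _; rewrite lee_fin exprn_ge0.
rewrite (_ : series _ = fine \o (fun n =>
   \sum_(0 <= i < n) \int[P]_(x in Z 0%N @^-1` [set i]) (u ^+ Z 0%N x)%:E)%E).
  exact: fine_cvg.
apply/funext => n /=; rewrite /series/=.
rewrite (eq_bigr (fun k => (waiting_law k * u ^+ k)%:E)) ?sumEFin// => k _.
rewrite (eq_integral (cst (u ^+ k)%:E)); last by move=> w; rewrite inE/= => ->.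
rewrite integral_cst; last exact: measurable_waiting.
rewrite EFinM [RHS]muleC; congr (_ * _)%E.
by rewrite /waiting_law fineK// fin_num_measure//; exact: measurable_waiting.
Qed.

End RenewalLaw.

(** * The waiting-time law of the fractional Bernoulli process *)

Section FractionalBernoulliLaw.
Context d (T : measurableType d) (R : realType) (P : probability T R).
Variables (alpha xi : R) (Z : nat -> {RV P >-> nat}).
Hypotheses (alpha_gt0 : 0 < alpha) (xi_gt0 : 0 < xi).
Hypothesis Z_fb : fractional_bernoulli alpha xi Z.

(* The generating function identity, cleared of denominators so that all
   coefficients are nonnegative. *)
Lemma fb_waiting_law :
  waiting_law Z + fps_const xi * nbinom alpha * waiting_law Z
  = fps_const xi * (fps_X R * nbinom alpha).
Proof.
case: Z_fb => _ ident Zgt0 gf; have a0 := ltW alpha_gt0; have x0 := ltW xi_gt0.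
have q0 := waiting_law_ge0 Z.
rewrite -mulrA; apply: has_sum_inj.
- move=> n; rewrite fpsD fpsM_const addr_ge0// mulr_ge0//.
  by apply: fps_ge0M => //; exact: nbinom_ge0.
- move=> n; rewrite fpsM_const mulr_ge0// fpsMX; case: n => // n.
  exact: nbinom_ge0.
move=> u u01; have /andP[u0 u1] := u01.
pose p := (1 - u) `^ alpha.
have p0 : 0 < p by rewrite powR_gt0// subr_gt0.
have sb := has_sum_nbinom u01 a0; rewrite powRN -/p in sb.
have sq : has_sum (waiting_law Z) u (xi * u / (xi + p)).
  by apply: waiting_law_gf => //; apply: gf; rewrite ger0_norm// ltW.
exists (xi * (u / p)).
  have -> : xi * (u / p) = xi * u / (xi + p) + xi * (p^-1 * (xi * u / (xi + p))).
    by field; rewrite !gt_eqF// addr_gt0.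
  apply: has_sumD => //; apply: has_sum_constM; apply: has_sumM => //.
  exact: nbinom_ge0.
by apply: has_sum_constM; apply: has_sumXM.
Qed.

(** Hence the [k]-th power of the law starts in degree [k], and all renewal sums are finite in each
    degree. *)
Lemma waiting_law_0 : waiting_law Z 0%N = 0.
Proof.
case: Z_fb => _ _ Zgt0 _; rewrite /waiting_law (_ : _ @^-1` _ = set0) ?measure0//.
by apply/seteqP; split => w //= Zw; have := Zgt0 0%N w; rewrite Zw.
Qed.

End FractionalBernoulliLaw.

(** * Gauss's limit formula for the Gamma function *)

Section GammaLimit.
Variable R : realType.
Implicit Types (a x : R).

Local Notation mu := (@lebesgue_measure R).

Lemma le1Bn_expr x n : 0 <= x <= 1 -> 1 - n%:R * x <= (1 - x) ^+ n.
Proof.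
move=> /andP[x0 x1]; elim: n => [|n IHn]; first by rewrite mul0r subr0.
rewrite exprS; apply: (@le_trans _ _ ((1 - x) * (1 - n%:R * x))).
  by rewrite -natr1; have := ler0n R n; nra.
by rewrite ler_wpM2l// subr_ge0.
Qed.

Lemma expr1Bdivn_le x n : 0 <= x <= n.+1%:R -> (1 - x / n.+1%:R) ^+ n.+1 <= expR (- x).
Proof.
move=> /andP[x0 xn]; have n0 : 0 < n.+1%:R :> R by [].
have -> : - x = n.+1%:R * (- (x / n.+1%:R)) by field; rewrite gt_eqF//= nat1r.
rewrite expRM_natl lerXn2r ?nnegrE ?expR_ge0//; last exact: expR_ge1Dx.
by rewrite subr_ge0 ler_pdivrMr// mul1r.
Qed.

(* [(1 - y) exp y >= (1 - y) (1 + y) = 1 - y ^ 2] at [y = x / n.+1]. *)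
Lemma expr1Bdivn_ge x n : 0 <= x <= n.+1%:R ->
  expR (- x) * (1 - x ^+ 2 / n.+1%:R) <= (1 - x / n.+1%:R) ^+ n.+1.
Proof.
move=> /andP[x0 xn]; have n0 : 0 < n.+1%:R :> R by [].
pose y := x / n.+1%:R.
have y01 : 0 <= y <= 1 by rewrite divr_ge0//= ler_pdivrMr// mul1r.
have /andP[y0 y1] := y01.
have -> : 1 - x ^+ 2 / n.+1%:R = 1 - n.+1%:R * y ^+ 2.
  by rewrite /y; field; rewrite gt_eqF//= nat1r.
have xE : x = n.+1%:R * y by rewrite /y mulrC divfK// gt_eqF.
rewrite -/y mulrC expRN -ler_pdivlMr ?invr_gt0 ?expR_gt0// invrK xE.
rewrite expRM_natl -exprMn; apply: (@le_trans _ _ ((1 - y ^+ 2) ^+ n.+1)).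
  by apply: le1Bn_expr; rewrite sqr_ge0/= expr_le1.
rewrite lerXn2r ?nnegrE ?subr_ge0 ?expr_le1 ?mulr_ge0 ?expR_ge0 ?subr_ge0//.
by have := expR_ge1Dx y; nra.
Qed.

Lemma cvg_expr1Bdivn x : 0 <= x ->
  (1 - x / n.+1%:R) ^+ n.+1 @[n --> \oo] --> expR (- x).
Proof.
move=> x0; apply: (@squeeze_cvgr _ _ _ _ (fun n => expR (- x) * (1 - x ^+ 2 / n.+1%:R))
  (fun=> expR (- x))); last exact: cvg_cst.
  near=> n; have xn : 0 <= x <= n.+1%:R.
    rewrite x0/= (le_trans (ltW (truncnS_gt _)))// ler_nat ltnS.
    by near: n; exists (Num.truncn x).
  by rewrite expr1Bdivn_ge// expr1Bdivn_le.
rewrite -[X in _ --> X]mulr1; apply: cvgM; first exact: cvg_cst.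
rewrite -[X in _ --> X]subr0; apply: cvgB; first exact: cvg_cst.
rewrite -[X in _ --> X](mulr0 (x ^+ 2)); apply: cvgM; first exact: cvg_cst.
exact: cvg_harmonic.
Unshelve. all: by end_near. Qed.

Lemma cvg_powR_at_right0 a : 0 <= a -> x `^ a @[x --> 0^'+] --> (0 : R) `^ a.
Proof.
rewrite le_eqVlt => /predU1P[<-|a0].
  rewrite powRr0; rewrite (_ : (fun x => _) = cst 1); first exact: cvg_cst.
  by apply/funext => x; rewrite powRr0.
by rewrite powR0 ?gt_eqF//; exact: powR_cvg0.
Qed.

Lemma continuous_at_powR a x : 0 < x -> {for x, continuous (fun y : R => y `^ a)}.
Proof.
move=> x0; apply: differentiable_continuous; apply/derivable1_diffP.
by apply: derivable_powR; rewrite in_itv/= x0.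
Qed.

Lemma within_continuous_powR a c : 0 <= a -> 0 < c ->
  {within `[0, c], continuous (fun y : R => y `^ a)}.
Proof.
move=> a0 c0; apply/continuous_within_itvP => //; split.
- by move=> x; rewrite in_itv/= => /andP[x0 _]; exact: continuous_at_powR.
- exact: cvg_powR_at_right0.
- by apply: cvg_at_left_filter; exact: continuous_at_powR.
Qed.

Lemma Rintegral_powR a c : 0 <= a -> 0 < c ->
  \int[mu]_(x in `[0, c]) (x `^ a) = c `^ (a + 1) / (a + 1).
Proof.
move=> a0 c0; have a10 : 0 < a + 1 by rewrite ltr_wpDl.
rewrite /Rintegral (@continuous_FTC2 _ _ (fun x => x `^ (a + 1) / (a + 1)))//.
- by rewrite powR0 ?gt_eqF// mul0r sube0.
- exact: within_continuous_powR.
- split.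
  + move=> x; rewrite in_itv/= => /andP[x0 _]; apply: derivableM => //.
    by apply: derivable_powR; rewrite in_itv/= x0.
  + by apply: cvgM; [apply: cvg_powR_at_right0; exact: ltW|exact: cvg_cst].
  + apply: cvgM; last exact: cvg_cst.
    by apply: cvg_at_left_filter; exact: continuous_at_powR.
- move=> x; rewrite in_itv/= => /andP[x0 _].
  have xin : x \in `]0, +oo[ by rewrite in_itv/= x0.
  rewrite derive1E deriveM//; last exact: derivable_powR.
  rewrite derive_cst scaler0 add0r -derive1E powR_derive1//= addrK.
  by rewrite /GRing.scale/= mulrA mulVf ?mul1r// gt_eqF.
Qed.

(* Evaluated by the recursion [I_(m+1)(a) = I_m(a) - I_m(a + 1) / N.+1] in [m],
   which needs neither integration by parts nor a change of variable. *)
Definition euler_integral (N m : nat) a :=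
  \int[mu]_(x in `[0, N.+1%:R]) (x `^ a * (1 - x / N.+1%:R) ^+ m).

Lemma continuous_euler_integrand N m a : 0 <= a ->
  {within `[0, N.+1%:R], continuous (fun x => x `^ a * (1 - x / N.+1%:R) ^+ m)}.
Proof.
move=> a0 x; apply: cvgM; first by apply: within_continuous_powR.
suff : continuous (fun y : R => (1 - y / N.+1%:R) ^+ m) by move=> /continuous_subspaceT; exact.
move=> y; apply: (@continuous_comp _ _ _ (fun y : R => 1 - y / N.+1%:R) (fun z => z ^+ m)).
  by apply: cvgB; [exact: cvg_cst|apply: cvgM; [exact: cvg_id|exact: cvg_cst]].
exact: exprn_continuous.
Qed.

Lemma integrable_euler_integrand N m a : 0 <= a ->
  mu.-integrable `[0, N.+1%:R] (EFin \o (fun x => x `^ a * (1 - x / N.+1%:R) ^+ m)).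
Proof.
move=> a0; apply: continuous_compact_integrable; first exact: segment_compact.
exact: continuous_euler_integrand.
Qed.

(** After scaling by [N + 1] this is the Beta integral [B(a + 1, m + 1) = m! / ((a + 1) ... (a + m +
    1))]. [N] and [m] are kept apart because the recursion lowers [m] on a fixed interval. *)
Lemma euler_integralE N m a : 0 <= a -> euler_integral N m a
  = N.+1%:R `^ (a + 1) / (nbinom (a + 1) m * (a + m.+1%:R)).
Proof.
have N0 : 0 < N.+1%:R :> R by [].
elim: m a => [|m IHm] a a0.
  rewrite nbinom_0 mul1r -Rintegral_powR//.
  by apply: eq_Rintegral => x _; rewrite expr0 mulr1.
have a10 : 0 <= a + 1 by rewrite addr_ge0.
have am0 (k : nat) : 0 < a + k.+1%:R by rewrite ltr_wpDl.
have nb0 : nbinom (a + 1) m != 0.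
  rewrite /nbinom prodf_seq_neq0; apply/allP => i _ /=.
  by rewrite mulf_neq0 ?invr_eq0 ?pnatr_eq0// -addrA nat1r gt_eqF.
have -> : euler_integral N m.+1 a
    = euler_integral N m a - N.+1%:R^-1 * euler_integral N m (a + 1).
  rewrite /euler_integral -RintegralZl//; last exact: integrable_euler_integrand.
  rewrite -RintegralB//; last 2 first.
  - exact: integrable_euler_integrand.
  - have := integrableZl _ N.+1%:R^-1 (integrable_euler_integrand N m a10).
    move=> /(_ (measurable_itv _)).
    by apply: eq_integrable => // x _; rewrite /= EFinM.
  apply: eq_Rintegral => x; rewrite inE/= in_itv/= => /andP[x0 _].
  rewrite powRD ?powRr1//; last first.
    by apply/implyP; rewrite gt_eqF// ltr_wpDl.
  by rewrite exprS; ring.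
rewrite !IHm//.
have h1 : m.+1%:R * nbinom (a + 1) m.+1 = (a + m.+1%:R) * nbinom (a + 1) m.
  by rewrite nbinomS -addrA nat1r.
have h2 : (a + 1) * nbinom (a + 1 + 1) m = (a + m.+1%:R) * nbinom (a + 1) m.
  by rewrite nbinom_shift -addrA nat1r.
have -> : nbinom (a + 1) m.+1 = (a + m.+1%:R) * nbinom (a + 1) m / m.+1%:R.
  by rewrite -h1 mulrC mulKf// pnatr_eq0.
have -> : nbinom (a + 1 + 1) m = (a + m.+1%:R) * nbinom (a + 1) m / (a + 1).
  by rewrite -h2 mulrC mulKf// gt_eqF// ltr_wpDl.
rewrite [_ `^ (a + 1 + 1)]powRD ?powRr1//; last first.
  by apply/implyP => _; rewrite gt_eqF.
rewrite -[m.+2%:R]nat1r; field.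
by rewrite nb0 nat1r [1 + m.+1%:R]nat1r nat1r pnatr_eq0/= !gt_eqF// ltr_wpDl.
Qed.

Definition gamma_integrand a x := x `^ a * expR (- x).

Lemma measurable_gamma_integrand a (D : set R) : measurable_fun D (gamma_integrand a).
Proof.
apply: measurable_funTS; apply: measurable_funM.
  exact: measurable_powR.
by apply: measurableT_comp => //; exact: measurable_expR.
Qed.

(** This leaves a factor [exp (- x / 2)] in the gamma integrand, which is then dominated by a
    multiple of the exponential density of rate [1 / 2]. The constant is read off a single term of
    the exponential series. *)
Lemma powR_le_expR a : 0 <= a -> exists2 K, 0 <= K &
  forall x, 0 < x -> x `^ a <= K * expR (x / 2).
Proof.
move=> a0; pose m := (Num.truncn a).
have K1 : 1 <= 2 ^+ m.+1 * m.+1`!%:R :> R.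
  by rewrite -natrX -natrM ler1n muln_gt0 expn_gt0 fact_gt0.
exists (2 ^+ m.+1 * m.+1`!%:R); first by apply: le_trans K1.
move=> x x0.
have e1 : 1 <= expR (x / 2) by have := expR_ge1Dx (x / 2); lra.
have [x1|x1] := leP x 1.
  apply: (@le_trans _ _ 1); last by rewrite -[leLHS]mulr1 ler_pM.
  by rewrite -(powRr0 x) ger_powR// x0.
apply: (@le_trans _ _ (x ^+ m.+1)).
  by rewrite -powR_mulrn ?(ltW x0)// ler_powR ?(ltW x1)// (ltW (truncnS_gt _)).
have h := @expR_ge1Dxn _ (x / 2) m.
have {h} h : (x / 2) ^+ m.+1 / m.+1`!%:R <= expR (x / 2).
  by apply: le_trans (h _); [rewrite lerDr|rewrite divr_ge0// ltW].
move: h; rewrite ler_pdivrMr ?ltr0n ?fact_gt0// expr_div_n ler_pdivrMr ?exprn_gt0//.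
by move=> h; apply: le_trans h _; rewrite le_eqVlt; apply/orP; left; apply/eqP; ring.
Qed.

Lemma integrable_gamma_integrand a : 0 <= a ->
  mu.-integrable `]0, +oo[ (EFin \o gamma_integrand a).
Proof.
move=> /powR_le_expR[K K0 aK].
have half0 : 0 < 2^-1 :> R by rewrite invr_gt0.
have iS : mu.-integrable `]0, +oo[ (EFin \o exponential_pdf (2^-1 : R)).
  by apply: integrableS (integrable_exponential_pdf half0).
have := integrableZl _ (2 * K) iS => /(_ (measurable_itv _)).
apply: le_integrable => //.
  by apply/measurable_EFinP; exact: measurable_gamma_integrand.
move=> x /=; rewrite in_itv/= andbT => x0.
rewrite lee_fin exponential_pdfE ?(ltW x0)// ger0_norm; last first.
  by rewrite mulr_ge0 ?powR_ge0 ?expR_ge0.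
apply: le_trans (ler_norm _).
have -> : 2 * K * (2^-1 * expR (- 2^-1 * x)) = K * expR (x / 2) * expR (- x).
  by rewrite -[RHS]mulrA -expRD (_ : x / 2 - x = - 2^-1 * x); [field|field].
by rewrite ler_wpM2r ?expR_ge0// aK.
Qed.

Lemma GammaE a : Gamma (a + 1) = \int[mu]_(x in `]0, +oo[) gamma_integrand a x.
Proof. by rewrite /Gamma addrK. Qed.

Lemma euler_integrand_le N x a : 0 <= x <= N.+1%:R ->
  x `^ a * (1 - x / N.+1%:R) ^+ N.+1 <= gamma_integrand a x.
Proof. by move=> xN; rewrite ler_wpM2l ?powR_ge0// expr1Bdivn_le. Qed.

Lemma euler_integrand_ge0 N m x a : 0 <= x <= N.+1%:R ->
  0 <= x `^ a * (1 - x / N.+1%:R) ^+ m.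
Proof.
move=> /andP[x0 xN]; rewrite mulr_ge0 ?powR_ge0// exprn_ge0// subr_ge0.
by rewrite ler_pdivrMr// mul1r.
Qed.

(** Extended by zero, so that dominated convergence runs on a domain independent of [N]. *)
Definition euler_integrand a N : R -> R :=
  (fun x => x `^ a * (1 - x / N.+1%:R) ^+ N.+1) \_ `[0, N.+1%:R].

Lemma measurable_euler_integrand a N (D : set R) : 0 <= a ->
  measurable_fun D (euler_integrand a N).
Proof.
move=> a0; apply: measurable_funTS.
apply: (measurable_restrictT _ (measurable_itv `[0, N.+1%:R])).1.
have := measurable_int mu (integrable_euler_integrand N N.+1 a0).
by move=> /measurable_EFinP.
Qed.

Lemma euler_integral_restrict a N : 0 <= a ->
  (\int[mu]_(x in `]0%R, +oo[) (euler_integrand a N x)%:E = (euler_integral N N.+1 a)%:E)%E.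
Proof.
move=> a0.
have -> : (fun x => (euler_integrand a N x)%:E)
    = (EFin \o (fun x => x `^ a * (1 - x / N.+1%:R) ^+ N.+1)) \_ `[0, N.+1%:R].
  by apply/funext => x; rewrite /euler_integrand !patchE; case: ifP.
rewrite -integral_mkcondr (_ : _ `&` _ = `]0, N.+1%:R]%classic); last first.
  apply/seteqP; split => x /=; rewrite !in_itv/= andbT.
    by move=> [-> /andP[_ ->]].
  by move=> /andP[x0 ->]; rewrite x0 ltW.
rewrite integral_itv_obnd_cbnd; last first.
  apply: measurable_funS (measurable_int mu (integrable_euler_integrand N N.+1 a0)) => //.
  by apply: subset_itvr; rewrite bnd_simp.
rewrite /euler_integral fineK//.
exact: integrable_fin_num (integrable_euler_integrand N N.+1 a0).
Qed.

(** Dominated convergence: [(1 - x / (n + 1)) ^ (n + 1)] tends to [exp (- x)] and stays below it. *)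
Lemma cvg_euler_integral a : 0 <= a ->
  euler_integral n n.+1 a @[n --> \oo] --> Gamma (a + 1).
Proof.
move=> a0; rewrite GammaE /Rintegral.
rewrite (_ : (fun n => _) = fine \o (fun n =>
   \int[mu]_(x in `]0%R, +oo[) (euler_integrand a n x)%:E)%E); last first.
  by apply/funext => n /=; rewrite euler_integral_restrict.
apply: fine_cvg; rewrite fineK; last first.
  exact: integrable_fin_num (integrable_gamma_integrand a0).
apply: (@dominated_cvg _ _ _ mu _ (measurable_itv _) _ _ (EFin \o gamma_integrand a)).
- move=> n; apply/measurable_EFinP; exact: measurable_euler_integrand.
- move=> x /=; rewrite in_itv/= andbT => x0.
  apply: cvg_EFin; first exact: nearW.
  apply: (@cvg_trans _ ((x `^ a * (1 - x / n.+1%:R) ^+ n.+1) @[n --> \oo])).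
    apply: near_eq_cvg; near=> n; rewrite /= /euler_integrand patchE mem_set//=.
    rewrite in_itv/= ltW//= (le_trans (ltW (truncnS_gt _)))// ler_nat ltnS.
    by near: n; exists (Num.truncn x).
  by apply: cvgM; [exact: cvg_cst|apply: cvg_expr1Bdivn; exact: ltW].
- by [].
- exact: integrable_gamma_integrand.
- move=> n x /=; rewrite in_itv/= andbT => x0.
  rewrite lee_fin /euler_integrand patchE; case: ifPn => [|_].
    rewrite inE/= in_itv/= => xn.
    by rewrite ger0_norm ?euler_integrand_le// euler_integrand_ge0.
  by rewrite normr0 mulr_ge0 ?powR_ge0 ?expR_ge0.
Unshelve. all: by end_near. Qed.

Lemma Gamma_gt0 a : 0 <= a -> 0 < Gamma (a + 1).
Proof.
(* The Euler integral over [[0, 1]] is a positive lower bound. *)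
move=> a0; apply: (@lt_le_trans _ _ (euler_integral 0 1 a)).
  rewrite euler_integralE// divr_gt0 ?powR_gt0// mulr_gt0 ?ltr_wpDl//.
  by rewrite /nbinom big_ord1 addr0 divr1 ltr_wpDl.
rewrite -lee_fin -euler_integral_restrict// GammaE fineK; last first.
  exact: integrable_fin_num (integrable_gamma_integrand a0).
apply: ge0_le_integral => //.
- move=> x _; rewrite lee_fin /euler_integrand patchE; case: ifPn => // xn.
  by rewrite inE/= in_itv/= in xn; exact: euler_integrand_ge0.
- apply/measurable_EFinP; exact: measurable_euler_integrand.
- by apply/measurable_EFinP; exact: measurable_gamma_integrand.
- move=> x _; rewrite lee_fin /euler_integrand patchE; case: ifPn => [|_].
    by rewrite inE/= in_itv/= => xn; exact: euler_integrand_le.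
  by rewrite mulr_ge0 ?powR_ge0 ?expR_ge0.
Qed.

Lemma cvg_nbinom_Gamma a : 0 <= a ->
  nbinom (a + 1) n / n%:R `^ a @[n --> \oo] --> (Gamma (a + 1))^-1.
Proof.
move=> a0; rewrite -(cvg_shiftS (fun n => nbinom (a + 1) n / n%:R `^ a)).
(* By the closed form, the quotient at [n + 1] is the reciprocal Euler integral times
   [(n + 1) / (a + n + 2)], which tends to 1. *)
rewrite (_ : [sequence _]_n =
   (fun n => (1 + (a + 1) * n.+1%:R^-1)^-1 * (euler_integral n n.+1 a)^-1)).
  rewrite -[(Gamma _)^-1]mul1r; apply: cvgM; last first.
    apply: cvgV; first by rewrite gt_eqF// Gamma_gt0.
    exact: cvg_euler_integral.
  rewrite -[X in _ --> X]invr1; apply: cvgV; first exact: oner_neq0.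
  rewrite -[X in _ --> X]addr0; apply: cvgD; first exact: cvg_cst.
  rewrite -[X in _ --> X](mulr0 (a + 1)); apply: cvgM; first exact: cvg_cst.
  exact: cvg_harmonic.
apply/funext => n /=; rewrite euler_integralE//.
rewrite powRD ?powRr1//; last by apply/implyP.
have N0 : 0 < n.+1%:R :> R by [].
have P0 : 0 < n.+1%:R `^ a :> R by rewrite powR_gt0.
have nb0 : 0 < nbinom (a + 1) n.+1.
  by rewrite prodr_gt0// => i _; rewrite divr_gt0// ltr_wpDr// ltr_wpDl.
rewrite -[n.+2%:R]natr1; field.
by rewrite !nat1r natr1 !gt_eqF// ltr_wpDl.
Qed.

End GammaLimit.

(** * The renewal equation and its Neumann series *)

Section FormalPowerSeriesDivision.
Variable K : idomainType.
Implicit Types a b c : fps K.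

(** Identifies the probabilistic solution of the renewal equation with the Neumann series, both
    solving the same linear equation. *)
Lemma fps_mulIr a b c : a 0%N != 0 -> b * a = c * a -> b = c.
Proof.
move=> a0 bac; have {bac} z0 : (b - c) * a = 0 by rewrite mulrBl bac subrr.
suff z n : (b - c) n = 0.
  by apply/funext => n; apply/eqP; rewrite -subr_eq0; apply/eqP; exact: z.
elim/ltn_ind: n => n IHn.
have := congr1 (@^~ n) z0; rewrite fpsM big_ord_recr/= subnn big1 ?add0r.
  by move=> /eqP; rewrite mulf_eq0 (negbTE a0) orbF => /eqP.
by move=> i _; rewrite IHn ?mul0r.
Qed.

Lemma fpsM_expr_lt a b k n : a 0%N = 0 -> (n < k)%N -> (b * a ^+ k) n = 0.
Proof.
move=> a0 nk; rewrite fpsM big1// => i _; rewrite fps_expr_lt ?mulr0//.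
by rewrite (leq_ltn_trans (leq_subr _ _)).
Qed.

Lemma fps_constM (x y : K) : fps_const (x * y) = fps_const x * fps_const y.
Proof. by apply/funext => -[|n]; rewrite fpsM_const//= mulr0. Qed.

Lemma fps_constX (x : K) k : fps_const (x ^+ k) = fps_const x ^+ k.
Proof. by elim: k => // k IHk; rewrite !exprS fps_constM IHk. Qed.

Lemma fps_constN (x : K) : fps_const (- x) = - fps_const x.
Proof. by apply/funext => -[|n]; rewrite fpsN//= oppr0. Qed.

End FormalPowerSeriesDivision.

Section RenewalSeries.
Variable R : realType.
Implicit Types (alpha xi lambda u : R).

Lemma fps_onesBX : fps_ones R * (1 - fps_X R) = 1.
Proof.
rewrite mulrBr mulr1 mulrC; apply/funext => n.
by rewrite fpsD fpsN fpsMX fps1; case: n => [|n]; rewrite ?subr0// subrr.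
Qed.

Definition fb_step alpha xi lambda : fps R :=
  fps_const (- xi) * (nbinom alpha * (1 - fps_const lambda * fps_X R)).

Definition fb_init alpha xi : fps R := fps_ones R + fps_const xi * nbinom alpha.

Definition fb_term alpha xi lambda k : fps R :=
  fb_step alpha xi lambda ^+ k * fb_init alpha xi.

(* For [q] the law of the waiting times this is [sum_k lambda ^ k Phi^(k)]; the
   terms with [k > n] vanish because [q 0 = 0]. *)
Definition renewal_fps (q : fps R) lambda : fps R :=
  fun n => \sum_(k < n.+1) lambda ^+ k * (fps_ones R * (q ^+ k - q ^+ k.+1)) n.

(** One truncation [N] serves all degrees below [N], so that ring identities apply to a single
    series instead of one sum per degree. *)
Lemma renewal_fps_trunc (q : fps R) lambda N n : q 0%N = 0 -> (n < N)%N ->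
  renewal_fps q lambda n =
  ((\sum_(k < N) (fps_const lambda * q) ^+ k) * (fps_ones R * (1 - q))) n.
Proof.
move=> q0 nN; rewrite mulr_suml fps_sum /renewal_fps.
rewrite (big_ord_widen_cond N predT
  (fun k => lambda ^+ k * (fps_ones R * (q ^+ k - q ^+ k.+1)) n))//=.
rewrite [RHS](bigID (fun k : 'I_N => (k < n.+1)%N))/= [X in _ = _ + X]big1 ?addr0.
  apply: eq_bigr => k _; rewrite exprMn -fps_constX -mulrA fpsM_const.
  congr (_ * _ ); congr ((_ : fps R) n); rewrite exprSr; ring.
move=> k; rewrite -leqNgt => nk; rewrite mulrC fpsM_expr_lt//.
by rewrite fpsM_const q0 mulr0.
Qed.

Lemma renewal_fps_eq (q : fps R) alpha xi lambda : q 0%N = 0 ->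
  q + fps_const xi * nbinom alpha * q = fps_const xi * (fps_X R * nbinom alpha) ->
  renewal_fps q lambda * (1 - fb_step alpha xi lambda) = fb_init alpha xi.
Proof.
move=> q0 qE; apply/funext => n.
pose S := \sum_(k < n.+1) (fps_const lambda * q) ^+ k.
transitivity ((S * (fps_ones R * (1 - q)) * (1 - fb_step alpha xi lambda)) n).
  rewrite [LHS]fpsM [RHS]fpsM; apply: eq_bigr => i _.
  by rewrite (@renewal_fps_trunc _ _ n.+1).
(* The law satisfies [q (1 + xi b) = xi b X], so [1 + xi b (1 - lambda X)] contains the factor
   [1 - lambda q], against which the geometric sum [S] telescopes up to degree [n]. *)
have -> : 1 - fb_step alpha xi lambda =
    (1 + fps_const xi * nbinom alpha) * (1 - fps_const lambda * q).
  rewrite /fb_step fps_constN; ring: (esym qE).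
have -> : S * (fps_ones R * (1 - q)) *
    ((1 + fps_const xi * nbinom alpha) * (1 - fps_const lambda * q)) =
  (S * (1 - fps_const lambda * q)) * fb_init alpha xi.
  have o1 : fps_ones R * fps_X R = fps_ones R - 1.
    by rewrite -fps_onesBX mulrBr mulr1 subKr.
  have bq : fps_const xi * nbinom alpha * q = fps_const xi * (fps_X R * nbinom alpha) - q.
    by rewrite -qE addrC addKr.
  rewrite /fb_init; ring: bq o1.
have -> : S * (1 - fps_const lambda * q) = 1 - (fps_const lambda * q) ^+ n.+1.
  by rewrite -opprB mulrN mulrC -subrX1 opprB.
rewrite mulrBl mul1r fpsD fpsN mulrC fpsM_expr_lt ?subr0//.
by rewrite fpsM_const q0 mulr0.
Qed.

End RenewalSeries.

(** * Interchange of limits *)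

Section DominatedSeries.
Variable R : realType.
Implicit Types (f : nat -> R) (M : R).

(** The ratio [2^-1] is the one that the radius produces: twice the value [4^-1] of [fb_radius]. *)
Lemma dominated_half_series f M : 0 <= M -> (forall k, `|f k| <= M * 2^-1 ^+ k) ->
  cvgn (series f) /\
  forall K, `|limn (series f) - series f K| <= 2 * M * 2^-1 ^+ K.
Proof.
move=> M0 fM.
have h0 : 0 <= 2^-1 :> R by rewrite invr_ge0.
have cf : cvgn (series f).
  apply: normed_cvg; apply: (@series_le_cvg _ _ (geometric M 2^-1)) => //.
  - by move=> n; exact: normr_ge0.
  - by move=> n /=; rewrite mulr_ge0// exprn_ge0.
  - by apply: is_cvg_geometric_series; rewrite ger0_norm// invf_lt1// ltr1n.
split => // K.
(* The subtracted term makes the induction close, as [M 2 ^ (- j) = 2 M 2 ^ (- j) - 2 M 2 ^ (- (j +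
   1))]. *)
have fin n : `|series f (K + n)%N - series f K|
    <= 2 * M * 2^-1 ^+ K - 2 * M * 2^-1 ^+ (K + n).
  elim: n => [|n IHn]; first by rewrite addn0 !subrr normr0.
  rewrite addnS seriesSr addrAC (le_trans (ler_normD _ _))//.
  have := fM (K + n)%N; move: IHn; rewrite exprS; lra.
have cK : (series f (K + n)%N - series f K) @[n --> \oo] --> limn (series f) - series f K.
  apply: cvgB; last exact: cvg_cst.
  rewrite (_ : (fun n => series f (K + n)%N) = (fun n => series f (n + K)%N)).
    by rewrite (cvg_shiftn K (series f)).
  by apply/funext => n; rewrite addnC.
rewrite -(cvg_lim _ (cvg_norm cK))//; apply: limr_le.
  by apply/cvg_ex; eexists; exact: cvg_norm cK.
near=> n; apply: le_trans (fin n) _.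
by rewrite gerBl mulr_ge0 ?mulr_ge0// exprn_ge0.
Unshelve. all: by end_near. Qed.

Lemma tannery (x : nat -> nat -> R) (y : nat -> R) M : 0 <= M ->
  (\forall n \near \oo, forall k, `|x n k| <= M * 2^-1 ^+ k) ->
  (forall k, x n k @[n --> \oo] --> y k) ->
  cvgn (series y) /\ limn (series (x n)) @[n --> \oo] --> limn (series y).
Proof.
move=> M0 xM xy.
have yM k : `|y k| <= M * 2^-1 ^+ k.
  rewrite -(cvg_lim _ (cvg_norm (xy k)))//; apply: limr_le.
    by apply/cvg_ex; eexists; exact: cvg_norm (xy k).
  by near=> n; near: n; apply: filterS xM => n; exact.
have [cy ytail] := dominated_half_series M0 yM.
split => //; apply/cvgrPdist_le => eps e0.
have hK : (2 * M * 2^-1 ^+ K) @[K --> \oo] --> (0 : R).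
  rewrite -[X in _ --> X](mulr0 (2 * M)); apply: cvgM; first exact: cvg_cst.
  by apply: cvg_expr; rewrite ger0_norm ?invf_lt1 ?invr_ge0// ltr1n.
have e4 : 0 < eps / 4 by rewrite divr_gt0.
have [K _ /(_ K (leqnn _))/= KM] := (cvgr0Pnorm_le _).1 hK _ e4.
have {}KM := le_trans (ler_norm _) KM.
have sK j : series (x n) j @[n --> \oo] --> series y j.
  elim: j => [|j IHj].
    rewrite (_ : (fun n => _) = cst (series y 0)); first exact: cvg_cst.
    by apply/funext => n; rewrite /series/= !big_geq.
  rewrite seriesSr (_ : (fun n => _) = fun n => series (x n) j + x n j).
    exact: cvgD.
  by apply/funext => n; rewrite seriesSr.
have := (cvgrPdist_le _ _).1 (sK K) _ e4.
move=> sKe; near=> n.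
have xnM : forall k, `|x n k| <= M * 2^-1 ^+ k by near: n; exact: xM.
have [_ /(_ K) xtail] := dominated_half_series M0 xnM.
have ye := ytail K.
have se : `|series y K - series (x n) K| <= eps / 4 by near: n; exact: sKe.
have -> : limn (series y) - limn (series (x n)) =
   (limn (series y) - series y K) + (series y K - series (x n) K)
   - (limn (series (x n)) - series (x n) K) by ring.
apply: le_trans (ler_normB _ _) _; apply: le_trans (lerD (ler_normD _ _) (lexx _)) _.
lra.
Unshelve. all: by end_near. Qed.

End DominatedSeries.

(** * Cauchy estimates and convergence of the Neumann series *)

Section CoefficientBounds.
Variable R : realType.
Implicit Types (a b f : fps R) (lambda u M alpha xi : R).

Definition fps_bounded u f M := forall n, `|f n| * u ^+ n <= M.

Lemma fps_boundedD u f g M M' :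
  0 <= u -> fps_bounded u f M -> fps_bounded u g M' -> fps_bounded u (f + g) (M + M').
Proof.
move=> u0 fM gM n; rewrite fpsD; apply: le_trans (lerD (fM n) (gM n)).
by rewrite -mulrDl ler_wpM2r ?exprn_ge0// ler_normD.
Qed.

Lemma fps_bounded_constM u x f M :
  fps_bounded u f M -> fps_bounded u (fps_const x * f) (`|x| * M).
Proof. by move=> fM n; rewrite fpsM_const normrM -mulrA ler_wpM2l. Qed.

Lemma fps_bounded_sum u f l : 0 <= u -> fps_ge0 f -> has_sum f u l ->
  fps_bounded u f l.
Proof.
move=> u0 f0 fl n; rewrite ger0_norm//.
have fu0 k : 0 <= f k * u ^+ k by rewrite mulr_ge0// exprn_ge0.
apply: le_trans (series_le_lim n.+1 fu0 fl).
by rewrite seriesSr lerDr /series/= sumr_ge0.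
Qed.

(** As [u ^ n <= u ^ i] for [i <= n], a partial sum of coefficients times [u ^ n] is at most the
    partial sum of the series at [u]. *)
Lemma fps_bounded_onesM u f l : 0 <= u <= 1 -> fps_ge0 f -> has_sum f u l ->
  fps_bounded u (fps_ones R * f) l.
Proof.
move=> /andP[u0 u1] f0 fl n; rewrite ger0_norm; last first.
  by apply: fps_ge0M => // k; exact: ler01.
have fu0 k : 0 <= f k * u ^+ k by rewrite mulr_ge0// exprn_ge0.
apply: le_trans (series_le_lim n.+1 fu0 fl).
rewrite fps_onesM /series/= mulr_suml !big_mkord ler_sum// => i _.
by rewrite ler_wpM2l// ler_wiXn2l// -ltnS.
Qed.

(** The factor 2 bounds [1 + |lambda| u]. *)
Lemma fps_bounded_1BX u lambda f M : 0 <= u <= 1 -> `|lambda| <= 1 ->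
  fps_bounded u f M -> fps_bounded u ((1 - fps_const lambda * fps_X R) * f) (2 * M).
Proof.
move=> /andP[u0 u1] l1 fM n.
rewrite mulrBl mul1r -mulrA fpsD fpsN fpsM_const fpsMX.
have M0 : 0 <= M by apply: le_trans (fM 0%N); rewrite mulr_ge0// exprn_ge0.
case: n => [|n]; first by rewrite mulr0 subr0; apply: le_trans (fM 0%N) _; lra.
apply: (@le_trans _ _ ((`|f n.+1| + `|f n|) * u ^+ n.+1)).
  rewrite ler_wpM2r ?exprn_ge0// (le_trans (ler_normB _ _))// lerD2l normrM.
  by rewrite ler_piMl.
have h : `|f n| * u ^+ n.+1 <= M.
  by rewrite exprS mulrCA (le_trans _ (fM n))// ler_piMl ?mulr_ge0 ?exprn_ge0.
by have := fM n.+1; rewrite mulrDl; lra.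
Qed.

(* Cauchy's estimate at radius [u]. The factor [fps_ones] of [fb_init] costs
   nothing, as partial sums of coefficients obey the same bound; a cruder
   estimate would lose a factor [1 / (1 - u)]. *)
Lemma fb_term_bound alpha xi lambda u k n :
  0 <= alpha -> 0 <= xi -> `|lambda| <= 1 -> 0 < u < 1 ->
  `|fb_term alpha xi lambda k n| <= (2 * (xi * (1 - u) `^ (- alpha))) ^+ k
     * (1 + xi * (1 - u) `^ (- alpha)) / u ^+ n.
Proof.
move=> al0 xi0 l1 /andP[u0 u1].
have u01 : 0 <= u <= 1 by rewrite !ltW.
have u01' : 0 <= u < 1 by rewrite u1 ltW.
pose p := (1 - u) `^ (- alpha).
have p0 : 0 <= p by rewrite powR_ge0.
have nbk j : has_sum (nbinom (alpha * j%:R)) u (p ^+ j).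
  have -> : p ^+ j = (1 - u) `^ (- (alpha * j%:R)).
    by rewrite -powR_mulrn// -powRrM mulNr.
  by apply: has_sum_nbinom => //; rewrite mulr_ge0.
have nbk0 j : fps_ge0 (nbinom (alpha * j%:R)) by apply: nbinom_ge0; rewrite mulr_ge0.
(* All signs are gathered in the powers of [- xi] and [1 - lambda X]; the last factor has
   nonnegative coefficients and is bounded by its values at [u]. *)
have termE : fb_term alpha xi lambda k = fps_const ((- xi) ^+ k) *
    ((1 - fps_const lambda * fps_X R) ^+ k * (nbinom (alpha * k%:R) * fb_init alpha xi)).
  by rewrite /fb_term /fb_step !exprMn fps_constX nbinomX; ring.
have initE : nbinom (alpha * k%:R) * fb_init alpha xi =
    fps_ones R * nbinom (alpha * k%:R) + fps_const xi * nbinom (alpha * k.+1%:R).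
  have -> : nbinom (alpha * k.+1%:R) = nbinom (alpha * k%:R) * nbinom alpha.
    by rewrite nbinomM -natr1 mulrDr mulr1.
  by rewrite /fb_init; ring.
have binit : fps_bounded u (nbinom (alpha * k%:R) * fb_init alpha xi)
    (p ^+ k + `|xi| * p ^+ k.+1).
  rewrite initE; apply: fps_boundedD; rewrite ?(ltW u0)//.
    exact: fps_bounded_onesM.
  by apply: fps_bounded_constM; apply: fps_bounded_sum => //; exact: ltW.
have bpow g Q j : fps_bounded u g Q ->
    fps_bounded u ((1 - fps_const lambda * fps_X R) ^+ j * g) (2 ^+ j * Q).
  move=> gQ; elim: j => [|j IHj]; first by rewrite !mul1r.
  by rewrite !exprS -!mulrA; exact: fps_bounded_1BX.
have := @fps_bounded_constM _ ((- xi) ^+ k) _ _ (bpow _ _ k binit) n.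
rewrite -termE ler_pdivlMr ?exprn_gt0// => /le_trans; apply.
rewrite normrX normrN (ger0_norm xi0) le_eqVlt; apply/orP; left; apply/eqP.
by rewrite -/p !exprMn exprS; ring.
Qed.

(** The radius [u] makes the terms of each fixed degree decay geometrically in [k]. The telescoped
    identity for partial sums then passes to the limit degree by degree, since a product involves
    finitely many coefficients in each degree. *)
Lemma fb_term_series alpha xi lambda : 0 <= alpha -> 0 <= xi -> `|lambda| <= 1 ->
  (exists2 u, 0 < u < 1 & 2 * (xi * (1 - u) `^ (- alpha)) <= 2^-1) ->
  let y : fps R := fun n => limn (series (fun k => fb_term alpha xi lambda k n)) in
  y * (1 - fb_step alpha xi lambda) = fb_init alpha xi.
Proof.
move=> al0 xi0 l1 [u u01 ru] y; set a := 1 - fb_step alpha xi lambda.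
have /andP[u0 u1] := u01.
set r := xi * _ in ru.
have r0 : 0 <= r by rewrite mulr_ge0 ?powR_ge0.
have cy n : cvgn (series (fun k => fb_term alpha xi lambda k n)).
  apply: (dominated_half_series (M := (1 + r) / u ^+ n) _ _).1.
    by rewrite divr_ge0 ?exprn_ge0 ?(ltW u0)// addr_ge0.
  move=> k; apply: le_trans (fb_term_bound k n al0 xi0 l1 u01) _.
  rewrite -/r -mulrA mulrC ler_wpM2l//.
    by rewrite divr_ge0 ?exprn_ge0 ?(ltW u0)// addr_ge0.
  by rewrite lerXn2r// nnegrE; lra.
apply/funext => n.
pose S K : fps R := \sum_(k < K) fb_term alpha xi lambda k.
have SE K m : S K m = series (fun k => fb_term alpha xi lambda k m) K.
  by rewrite /S fps_sum /series/= big_mkord.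
have aS K : S K * a = fb_init alpha xi - fb_term alpha xi lambda K.
  rewrite /S /fb_term -mulr_suml mulrAC /a.
  rewrite (_ : (\sum_(i < K) _) * _ = 1 - fb_step alpha xi lambda ^+ K).
    by rewrite mulrBl mul1r.
  by rewrite -opprB mulrN mulrC -subrX1 opprB.
have l1' : (S K * a) n @[K --> \oo] --> (y * a) n.
  rewrite fpsM (_ : (fun K => _) = fun K => \sum_(i < n.+1) S K i * a (n - i)%N)//.
  apply: cvg_big => [|i _]; first by move=> [x1 x2]; exact: add_continuous.
  apply: cvgM; last exact: cvg_cst.
  rewrite (_ : (fun K => _) = series (fun k => fb_term alpha xi lambda k i))//.
  by apply/funext => K.
have l2 : (S K * a) n @[K --> \oo] --> fb_init alpha xi n - 0.
  rewrite (_ : (fun K => _) = fun K => fb_init alpha xi n - fb_term alpha xi lambda K n).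
    by apply: cvgB; [exact: cvg_cst|exact: cvg_series_cvg_0].
  by apply/funext => K; rewrite aS fpsD fpsN.
by rewrite subr0 in l2; rewrite -(cvg_lim _ l1')// -(cvg_lim _ l2).
Qed.

End CoefficientBounds.

(** * The scalar limit *)

Section ScalarLimit.
Variable R : realType.
Implicit Types (f : fps R) (alpha beta lambda x l : R).

Lemma invr_powR x beta : 0 <= x -> x^-1 `^ beta = (x `^ beta)^-1.
Proof. by move=> x0; rewrite -(powR_inv1 x0) -powRrM mulN1r powRN. Qed.

Lemma cvg_ratioS beta : (n%:R / n.+1%:R : R) `^ beta @[n --> \oo] --> (1 : R).
Proof.
have lim1 : (n%:R / n.+1%:R : R) @[n --> \oo] --> (1 : R).
  rewrite (_ : (fun n : nat => _) = fun n => 1 - n.+1%:R^-1).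
    rewrite -[X in _ --> X]subr0; apply: cvgB; first exact: cvg_cst.
    exact: cvg_harmonic.
  by apply/funext => n; rewrite -{1}[n%:R](addrK 1) natr1; field; rewrite nat1r.
have := cvg_comp _ _ lim1 (@continuous_at_powR R beta 1 ltr01).
by rewrite /= powR1.
Qed.

(** On leading asymptotics of power type, multiplication by [1 - lambda X] acts as its value at
    [X = 1]. *)
Lemma cvg_fps_1BX f beta lambda l :
  f n / n%:R `^ beta @[n --> \oo] --> l ->
  ((1 - fps_const lambda * fps_X R) * f) n / n%:R `^ beta @[n --> \oo] --> (1 - lambda) * l.
Proof.
move=> fl; rewrite -(cvg_shiftS (fun n => _ n / n%:R `^ beta)).
have fl' : f n.+1 / n.+1%:R `^ beta @[n --> \oo] --> l.
  by rewrite (cvg_shiftS (fun n => f n / n%:R `^ beta)).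
apply: (@cvg_trans _ ((f n.+1 / n.+1%:R `^ beta - lambda *
    ((f n / n%:R `^ beta) * (n%:R / n.+1%:R) `^ beta)) @[n --> \oo])).
  apply: near_eq_cvg; near=> n => /=.
  have -> : ((1 - fps_const lambda * fps_X R) * f) n.+1 = f n.+1 - lambda * f n.
    by rewrite mulrBl mul1r -mulrA fpsD fpsN fpsM_const fpsMX.
  have n0 : 0 < n%:R :> R by rewrite ltr0n; near: n; exists 1%N.
  rewrite powRM ?invr_ge0 ?ler0n// invr_powR//.
  have ? : n%:R `^ beta != 0 by rewrite gt_eqF ?powR_gt0.
  have ? : n.+1%:R `^ beta != 0 :> R by rewrite gt_eqF ?powR_gt0.
  by field; apply/andP.
rewrite mulrBl mul1r; apply: cvgB => //; apply: cvgM; first exact: cvg_cst.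
rewrite -[X in _ --> X]mulr1; apply: cvgM => //; exact: cvg_ratioS.
Unshelve. all: by end_near. Qed.

Lemma cvg_fps_1BX_expr f beta lambda l k :
  f n / n%:R `^ beta @[n --> \oo] --> l ->
  ((1 - fps_const lambda * fps_X R) ^+ k * f) n / n%:R `^ beta @[n --> \oo]
    --> (1 - lambda) ^+ k * l.
Proof.
move=> fl; elim: k => [|k IHk]; first by rewrite !expr0 !mul1r.
by rewrite !exprS -!mulrA; exact: cvg_fps_1BX.
Qed.

(** The coefficient is only of order [n ^ (beta - 1)]; for this reason the part [xi b] of [fb_init]
    disappears in the limit. [nbinom_shift] reduces the claim to the exponent [beta + 1]. *)
Lemma cvg_nbinom_0 beta : 0 < beta ->
  nbinom beta n / n%:R `^ beta @[n --> \oo] --> (0 : R).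
Proof.
move=> b0.
rewrite (_ : (fun n => _) =
  fun n => beta * (nbinom (beta + 1) n / n%:R `^ beta) / (beta + n%:R)).
  rewrite -[X in _ --> X](mulr0 (beta * (Gamma (beta + 1))^-1)); apply: cvgM.
    by apply: cvgM; [exact: cvg_cst|apply: cvg_nbinom_Gamma; exact: ltW].
  apply: (@squeeze_cvgr _ _ _ _ (fun=> 0) (fun n => n%:R^-1)); last 2 first.
  - exact: cvg_cst.
  - by rewrite -(cvg_shiftS (fun n => n%:R^-1 : R)); exact: cvg_harmonic.
  near=> n; have n0 : 0 < n%:R :> R by rewrite ltr0n; near: n; exists 1%N.
  by rewrite invr_ge0 addr_ge0 ?(ltW b0)//= lef_pV2 ?posrE ?addr_gt0// lerDr ltW.
apply/funext => n; rewrite mulrA nbinom_shift.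
have bn : beta + n%:R != 0 by rewrite gt_eqF// ltr_pwDl.
by move: (n%:R `^ beta)^-1 => w; field.
Unshelve. all: by end_near. Qed.

Lemma fb_term_cvg alpha x lambda k : 0 < alpha ->
  fb_term alpha (x / n%:R `^ alpha) lambda k n @[n --> \oo]
  --> (- x * (1 - lambda)) ^+ k / Gamma (alpha * k%:R + 1).
Proof.
move=> al0.
pose W := (1 - fps_const lambda * fps_X R) ^+ k.
(* [A] stems from the summand [1 / (1 - X)] of [fb_init] and [B] from [xi b]; the powers of [n] in
   the denominators are exactly those supplied by the powers of [xi]. *)
pose A n := (W * nbinom (alpha * k%:R + 1)) n / n%:R `^ (alpha * k%:R).
pose B n := (W * nbinom (alpha * k.+1%:R)) n / n%:R `^ (alpha * k.+1%:R).
have k0 : 0 <= alpha * k%:R by rewrite mulr_ge0// ltW.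
have kS0 : 0 < alpha * k.+1%:R by rewrite mulr_gt0.
have Al : A @ \oo --> (1 - lambda) ^+ k * (Gamma (alpha * k%:R + 1))^-1.
  by apply: cvg_fps_1BX_expr; exact: cvg_nbinom_Gamma.
have Bl : B @ \oo --> (1 - lambda) ^+ k * 0.
  by apply: cvg_fps_1BX_expr; exact: cvg_nbinom_0.
apply: (@cvg_trans _ (((- x) ^+ k * (A n + x * B n)) @[n --> \oo])); last first.
  rewrite exprMn -mulrA; apply: cvgM; first exact: cvg_cst.
  rewrite -[X in _ --> X]addr0; apply: cvgD => //.
  rewrite -[X in _ --> X](mulr0 x) -(mulr0 ((1 - lambda) ^+ k)); apply: cvgM => //.
  exact: cvg_cst.
apply: near_eq_cvg; near=> n => /=.
have n0 : 0 < n%:R :> R by rewrite ltr0n; near: n; exists 1%N.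
have -> : fb_term alpha (x / n%:R `^ alpha) lambda k =
   fps_const ((- (x / n%:R `^ alpha)) ^+ k) * (W * nbinom (alpha * k%:R + 1)
   + fps_const (x / n%:R `^ alpha) * (W * nbinom (alpha * k.+1%:R))).
  have -> : nbinom (alpha * k.+1%:R) = nbinom (alpha * k%:R) * nbinom alpha.
    by rewrite nbinomM -natr1 mulrDr mulr1.
  rewrite -nbinomM nbinom1 /fb_term /fb_step /fb_init !exprMn nbinomX fps_constX -/W.
  by ring.
rewrite fpsM_const fpsD fpsM_const /A /B -mulNr expr_div_n.
rewrite -[(_ `^ alpha) ^+ k]powR_mulrn ?powR_ge0// -powRrM.
have -> : n%:R `^ (alpha * k.+1%:R) = n%:R `^ (alpha * k%:R) * n%:R `^ alpha :> R.
  by rewrite -natr1 mulrDr mulr1 powRD//; apply/implyP => _; rewrite gt_eqF.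
have ? : n%:R `^ (alpha * k%:R) != 0 by rewrite gt_eqF ?powR_gt0.
have ? : n%:R `^ alpha != 0 :> R by rewrite gt_eqF ?powR_gt0.
by field; apply/andP.
Unshelve. all: by end_near. Qed.

(* The radius [u = 1 - c / n], with [c ^ alpha = 4 x], balances the growth of
   [(1 - u) ^ (- alpha)] against the decay of [xi = x / n ^ alpha]. *)
Lemma fb_radius alpha x (n : nat) : 0 < alpha -> 0 < x ->
  0 < n%:R :> R ->
  x / n%:R `^ alpha * (1 - (1 - (4 * x) `^ alpha^-1 / n%:R)) `^ (- alpha) = 4^-1.
Proof.
move=> al0 x0 n0; have c0 : 0 < (4 * x) `^ alpha^-1 by rewrite powR_gt0// mulr_gt0.
rewrite subKr powRN powRM ?invr_ge0 ?(ltW c0) ?(ltW n0)//.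
rewrite invr_powR ?(ltW n0)//.
rewrite -powRrM mulVf ?gt_eqF// powRr1 ?mulr_ge0 ?(ltW x0)//.
have ? : n%:R `^ alpha != 0 by rewrite gt_eqF ?powR_gt0.
by field; apply/andP; split => //; rewrite gt_eqF.
Qed.

Lemma fb_series_cvg alpha x lambda : 0 < alpha -> 0 < x -> `|lambda| <= 1 ->
  [/\ \forall n \near \oo, exists2 u, 0 < u < 1 &
        2 * (x / n%:R `^ alpha * (1 - u) `^ (- alpha)) <= 2^-1,
      cvgn (series (fun k => (- x * (1 - lambda)) ^+ k / Gamma (alpha * k%:R + 1))) &
      limn (series (fun k => fb_term alpha (x / n%:R `^ alpha) lambda k n)) @[n --> \oo]
        --> mittag_leffler alpha (- x * (1 - lambda))].
Proof.
move=> al0 x0 l1; pose c := (4 * x) `^ alpha^-1.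
have c0 : 0 < c by rewrite powR_gt0// mulr_gt0.
pose u n := 1 - c / n%:R.
have large : \forall n \near \oo, [/\ 0 < n%:R :> R & 2 * c <= n%:R].
  exists (Num.truncn (2 * c)).+1 => // n /= nc.
  have h : 2 * c < n%:R by apply: lt_le_trans (truncnS_gt _) _; rewrite ler_nat.
  by split; [apply: lt_trans h; rewrite mulr_gt0|exact: ltW].
have u01 n : 0 < n%:R :> R -> 2 * c <= n%:R -> 0 < c / n%:R <= 2^-1.
  by move=> n0 nc; rewrite divr_gt0//= ler_pdivrMr//; lra.
(* [5 / 4] is [1 + xi (1 - u) ^ (- alpha)] at the chosen radius, and [exp (2 c)] bounds
   [u ^ (- n) = (1 - c / n) ^ (- n)]. *)
have M0 : 0 <= 5 / 4 * expR (2 * c) by rewrite mulr_ge0 ?expR_ge0//; lra.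
suff dom : \forall n \near \oo, forall k,
    `|fb_term alpha (x / n%:R `^ alpha) lambda k n| <= 5 / 4 * expR (2 * c) * 2^-1 ^+ k.
  have [cml lml] := tannery M0 dom (fun k => @fb_term_cvg alpha x lambda k al0).
  split => //; apply: filterS large => n [n0 nc].
  have /andP[y0 y1] := u01 n n0 nc.
  by exists (u n); [rewrite /u; lra|rewrite /u fb_radius//; lra].
apply: filterS large => n [n0 nc] k.
have /andP[y0 y1] := u01 n n0 nc.
have un01 : 0 < u n < 1 by rewrite /u; lra.
have xi0 : 0 <= x / n%:R `^ alpha by rewrite divr_ge0 ?powR_ge0// ltW.
apply: le_trans (fb_term_bound k n (ltW al0) xi0 l1 un01) _.
rewrite /u fb_radius// -/(u n).
have -> : 2 * 4^-1 = 2^-1 :> R by field.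
rewrite -mulrA mulrC ler_wpM2r ?exprn_ge0 ?invr_ge0//.
have -> : 1 + 4^-1 = 5 / 4 :> R by field.
apply: ler_wpM2l; first lra.
have -> : 2 * c = n%:R * (2 * (c / n%:R)) by field; rewrite gt_eqF.
rewrite expRM_natl -exprVn lerXn2r ?nnegrE ?expR_ge0//.
  by rewrite invr_ge0; lra.
rewrite -[leLHS]mul1r ler_pdivrMr; last lra.
(* [(1 - y) (1 + 2 y) >= 1] for [0 <= y <= 1 / 2], applied at [y = c / n]. *)
have := expR_ge1Dx (2 * (c / n%:R)); rewrite /u; nra.
Qed.

End ScalarLimit.

(** * Spectral calculus *)

(** Read off Gauss's limit at [a = 0], where the sequence is constantly 1. *)
Lemma Gamma1 (R : realType) : Gamma (1 : R) = 1.
Proof.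
have h := @cvg_nbinom_Gamma R 0 (lexx _); rewrite add0r in h.
apply: invr_inj; rewrite invr1 -(cvg_lim _ h)//.
rewrite (_ : (fun n => _) = cst 1); first exact: lim_cst.
by apply/funext => n; rewrite powRr0 divr1 nbinom1.
Qed.

Lemma mittag_leffler0 (R : realType) (alpha : R) : mittag_leffler alpha 0 = 1.
Proof.
apply: cvg_lim => //; rewrite -cvg_shiftS; apply: cvg_near_cst; near=> n.
rewrite /= /series/= big_nat_recl// mulr0 add0r Gamma1 divr1 expr0 big1 ?addr0//.
by move=> i _; rewrite exprS !mul0r.
Unshelve. all: by end_near. Qed.

Section SpectralCalculus.
Variables (R : realType) (N : nat).
Variables (v : 'I_N.+1 -> 'cV[R]_N.+1) (vbar : 'I_N.+1 -> 'rV[R]_N.+1).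
Hypothesis v_complete : \sum_m v m *m vbar m = 1%:M.
Implicit Types (M : 'M[R]_N.+1) (mu : 'I_N.+1 -> R).

Lemma spectral_expr M mu k : (forall m, M *m v m = mu m *: v m) ->
  M ^+ k = \sum_m mu m ^+ k *: (v m *m vbar m).
Proof.
move=> Mv.
have Mkv m : M ^+ k *m v m = mu m ^+ k *: v m.
  elim: k => [|k IHk]; first by rewrite !expr0 mul1mx scale1r.
  by rewrite !exprS -mulmxE -mulmxA IHk -scalemxAr Mv scalerA mulrC.
rewrite -[LHS]mulmx1 -v_complete mulmx_sumr; apply: eq_bigr => m _.
by rewrite mulmxA Mkv scalemxAl.
Qed.

Lemma cvg_sum_scale (T : Type) (F : set_system T) (FF : Filter F)
    (c : T -> 'I_N.+1 -> R) (l : 'I_N.+1 -> R) (V : 'I_N.+1 -> 'M[R]_N.+1) :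
  (forall m, c x m @[x --> F] --> l m) ->
  \sum_m c x m *: V m @[x --> F] --> \sum_m l m *: V m.
Proof.
move=> cl; apply: cvg_big => [|m _]; first by move=> [x y]; exact: add_continuous.
by apply: cvgZl; exact: cl.
Qed.

(** Serves both sides of the theorem: the walk, with the state probabilities and [H], and the
    Mittag-Leffler function, with the reciprocal Gamma values and a multiple of [1 - H]. *)
Lemma lim_spectral_series (s : nat -> R) M mu (l : 'I_N.+1 -> R) :
  (forall m, M *m v m = mu m *: v m) ->
  (forall m, series (fun k => s k * mu m ^+ k) @ \oo --> l m) ->
  limn (series (fun k => s k *: M ^+ k)) = \sum_m l m *: (v m *m vbar m).
Proof.
move=> Mv sl; apply: cvg_lim => //.
rewrite (_ : series _ = fun K =>
  \sum_m series (fun k => s k * mu m ^+ k) K *: (v m *m vbar m)).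
  exact: cvg_sum_scale.
apply/funext => K; rewrite /series/=.
under [RHS]eq_bigr do rewrite scaler_suml.
rewrite exchange_big/=; apply: eq_bigr => k _.
rewrite (spectral_expr k Mv) scaler_sumr; apply: eq_bigr => m _.
by rewrite scalerA.
Qed.

End SpectralCalculus.

(** * The transition matrix of the walk in spectral form *)

Section WalkSpectralForm.
Context d (T : measurableType d) (R : realType) (P : probability T R).
Variables (alpha xi : R) (Z : nat -> {RV P >-> nat}).
Hypotheses (alpha_gt0 : 0 < alpha) (xi_gt0 : 0 < xi).
Hypothesis Z_fb : fractional_bernoulli alpha xi Z.

Lemma cvg_state_series lambda t :
  series (fun k => state_probability Z k t * lambda ^+ k) @ \oo
    --> renewal_fps (waiting_law Z) lambda t.
Proof.
case: (Z_fb) => indep ident _ _; have q0 := waiting_law_0 Z_fb.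
apply: cvg_near_cst; near=> K.
have tK : (t < K)%N by near: K; exists t.+1.
rewrite /renewal_fps /series/= (big_cat_nat (n := t.+1))//= [X in _ + X]big1_seq ?addr0.
  rewrite big_mkord; apply: eq_bigr => k _.
  by rewrite state_probabilityE// mulrC.
move=> k; rewrite andTb mem_index_iota => /andP[tk _].
by rewrite state_probabilityE// mulrBr fpsD fpsN !fpsM_expr_lt ?subrr ?mul0r// ltnW.
Unshelve. all: by end_near. Qed.

Lemma renewal_fps_series lambda t : `|lambda| <= 1 ->
  (exists2 u, 0 < u < 1 & 2 * (xi * (1 - u) `^ (- alpha)) <= 2^-1) ->
  renewal_fps (waiting_law Z) lambda t
  = limn (series (fun k => fb_term alpha xi lambda k t)).
Proof.
move=> l1 hu.
have yE := fb_term_series (ltW alpha_gt0) (ltW xi_gt0) l1 hu.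
have pE := renewal_fps_eq lambda (waiting_law_0 Z_fb) (fb_waiting_law alpha_gt0 xi_gt0 Z_fb).
(* The constant term is [1 + xi]. *)
have a0 : (1 - fb_step alpha xi lambda) 0%N != 0.
  rewrite fpsD fpsN fps1 /fb_step fpsM_const fpsM big_ord1 nbinom_0 fpsD fpsN fps1.
  by rewrite fpsM_const mulr0 subr0 mul1r mulr1 opprK gt_eqF// addr_gt0.
by rewrite (fps_mulIr a0 (etrans pE (esym yE))).
Qed.

Lemma fb_walkE (N : nat) (H : 'M[R]_N.+1) (lambda : 'I_N.+1 -> R)
    (v : 'I_N.+1 -> 'cV[R]_N.+1) (vbar : 'I_N.+1 -> 'rV[R]_N.+1) t :
  \sum_m v m *m vbar m = 1%:M -> (forall m, H *m v m = lambda m *: v m) ->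
  (forall m, `|lambda m| <= 1) ->
  (exists2 u, 0 < u < 1 & 2 * (xi * (1 - u) `^ (- alpha)) <= 2^-1) ->
  fb_walk H Z t = \sum_m limn (series (fun k => fb_term alpha xi (lambda m) k t))
                           *: (v m *m vbar m).
Proof.
move=> v1 Hv l1 hu; apply: (lim_spectral_series v1 Hv) => m.
by rewrite -renewal_fps_series//; exact: cvg_state_series.
Qed.

End WalkSpectralForm.

(** Reduces the limit [h -> 0] to a limit over the number of steps [n = t / h]. *)
Lemma cvg_truncn_div (R : realType) (t : R) (A : set R) : 0 < t ->
  Num.truncn (t / h) @[h --> within A 0^'+] --> \oo.
Proof.
move=> t0; apply/cvgnyPge => n; rewrite near_withinE.
near=> h => _.
have h0 : 0 < h by near: h; exact: nbhs_right_gt.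
have hn : h < t / n.+1%:R by near: h; apply: nbhs_right_lt; rewrite divr_gt0.
rewrite truncn_ge_nat ?divr_ge0 ?(ltW t0) ?(ltW h0)// ler_pdivlMr//.
by move: hn; rewrite ltr_pdivlMr// -natr1; lra.
Unshelve. all: by end_near. Qed.

Theorem mainTheorem13 (R : realType) (alpha xi0 : R)
    (alpha_gt0 : 0 < alpha) (alpha_lt1 : alpha < 1) (xi0_gt0 : 0 < xi0)
    (N : nat) (e : rel 'I_N.+1)
    (e_simple : simple_graph e) (e_connected : graph_connected e)
    (e_nonbipartite : ~ bipartite e)
    (lambda : 'I_N.+1 -> R) (v : 'I_N.+1 -> 'cV[R]_N.+1)
    (vbar : 'I_N.+1 -> 'rV[R]_N.+1)
    (spectral : spectral_data (walk_mx R e) lambda v vbar)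
    (d : R -> measure_display) (Om : forall xi : R, measurableType (d xi))
    (Pr : forall xi : R, probability (Om xi) R)
    (Z : forall xi : R, nat -> {RV (Pr xi) >-> nat})
    (Z_fb : forall xi : R, 0 < xi -> fractional_bernoulli alpha xi (Z xi))
    (t : R) (t_gt0 : 0 < t) :
  (fb_walk (walk_mx R e) (Z (xi0 * h `^ alpha)) (Num.truncn (t / h))
     @[h --> within [set h : R | t / h \is a Num.nat] 0^'+]
     --> mittag_leffler_mx alpha (- (xi0 * t `^ alpha) *: (1%:M - walk_mx R e)))
  /\
  mittag_leffler_mx alpha (- (xi0 * t `^ alpha) *: (1%:M - walk_mx R e))
    = v ord0 *m vbar ord0
      + \sum_(m | m != ord0)
          mittag_leffler alpha (- xi0 * (1 - lambda m) * t `^ alpha)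
            *: (v m *m vbar m).
Proof.
case: spectral => -[lam0 lamlt] Hv _ [_ v1] _.
(* With [n = t / h] the parameter [xi0 h ^ alpha] becomes [x / n ^ alpha], the scaling of the scalar
   limit. *)
pose x := xi0 * t `^ alpha; pose H := walk_mx R e.
have x0 : 0 < x by rewrite mulr_gt0// powR_gt0.
have lam1 m : `|lambda m| <= 1.
  by have [->|/lamlt/ltW//] := eqVneq m ord0; rewrite lam0 normr1.
have lims m := fb_series_cvg alpha_gt0 x0 (lam1 m).
have Mv m : (- x *: (1%:M - H)) *m v m = (- x * (1 - lambda m)) *: v m.
  by rewrite -scalemxAl mulmxBl mul1mx Hv -scalerA scalerBl scale1r.
have mlE : mittag_leffler_mx alpha (- x *: (1%:M - H)) =
    \sum_m mittag_leffler alpha (- x * (1 - lambda m)) *: (v m *m vbar m).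
  apply: (lim_spectral_series v1 Mv) => m; have [_ cml _] := lims m.
  rewrite (_ : (fun k => _) =
    (fun k => (- x * (1 - lambda m)) ^+ k / Gamma (alpha * k%:R + 1)))//.
  by apply/funext => k; rewrite mulrC.
split; last first.
  rewrite -/x -/H mlE (bigD1 ord0)//= lam0 subrr mulr0 mittag_leffler0 scale1r.
  congr (_ + _); apply: eq_bigr => m _; congr (mittag_leffler _ _ *: _).
  by rewrite /x; ring.
rewrite -/x -/H mlE.
pose G n := \sum_m limn (series (fun k => fb_term alpha (x / n%:R `^ alpha) (lambda m) k n))
  *: (v m *m vbar m).
have GL : G @ \oo --> \sum_m mittag_leffler alpha (- x * (1 - lambda m)) *: (v m *m vbar m).
  by apply: cvg_sum_scale => m; case: (lims m).
have truncn_oo := @cvg_truncn_div R t [set h | t / h \is a Num.nat] t_gt0.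
apply: cvg_trans; last exact: (cvg_comp _ _ truncn_oo GL).
apply: near_eq_cvg.
(* The radius condition does not involve the eigenvalue, so any index supplies it. *)
have [rad _ _] := lims ord0.
have radh := truncn_oo _ rad.
near=> h.
have h0 : 0 < h by near: h; rewrite near_withinE; apply: filterS (nbhs_right_gt 0) => h h0 _.
have [u u01 ru] : exists2 u, 0 < u < 1 &
  2 * (x / (Num.truncn (t / h))%:R `^ alpha * (1 - u) `^ (- alpha)) <= 2^-1.
  by near: h; exact: radh.
have hnat : t / h \is a Num.nat by near: h; rewrite near_withinE; exact: nearW.
have xiE : xi0 * h `^ alpha = x / (Num.truncn (t / h))%:R `^ alpha.
  rewrite truncnK// powRM ?invr_ge0 ?ltW// invr_powR ?ltW// /x.
  by field; rewrite !gt_eqF// powR_gt0.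
have xi_gt0 : 0 < xi0 * h `^ alpha by rewrite mulr_gt0// powR_gt0.
rewrite /= /G (fb_walkE alpha_gt0 xi_gt0 (Z_fb _ xi_gt0) _ v1 Hv lam1).
  by rewrite xiE.
by exists u => //; rewrite xiE.
Unshelve. all: by end_near. Qed.
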